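(* Let $(X,\mathcal M,m)$, $p$, $f$, $\mu$, $h$, $q$ and the quadratic form $\mathcal E$ of $p$ be as described in the context. (i) If $u\in L^2(m)$ and $u=0$ on $\{x\in X: h(x)=0\text{ or }h(x)=\infty\}$, then $$\mathcal E(u,u)\ge \int_X u(x)^2q(x)\,m(dx)+\liminf_{t\to0}\int_X\int_X\frac{p_t(x,y)}{2t}\left(\frac{u(x)}{h(x)}-\frac{u(y)}{h(y)}\right)^2h(y)h(x)\,m(dy)\,m(dx).$$ (ii) If $f(t)=t_+^\beta$ with $\beta\ge0$ (where $t_+=\max(t,0)$) or, more generally, if $f$ is absolutely continuous and there are $\delta>0$ and $c<\infty$ such that $$\frac{f(s)-f(s-t)}{t}\le c\,f'(s)\qquad\text{for all } s>0\text{ and }0<t<\delta,$$ then for every $u\in L^2(m)$ $$\mathcal E(u,u)= \int_X u(x)^2q(x)\,m(dx)+\lim_{t\to0}\int_X\int_X\frac{p_t(x,y)}{2t}\left(\frac{u(x)}{h(x)}-\frac{u(y)}{h(y)}\right)^2h(y)h(x)\,m(dy)\,m(dx).$$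
   Context: $(X,\mathcal M,m)$ is a $\sigma$-finite measure space. The function $p:(0,\infty)\times X\times X\to[0,\infty]$, $(t,x,y)\mapsto p_t(x,y)$, is $\mathcal B_{(0,\infty)}\times\mathcal M\times\mathcal M$-measurable (where $\mathcal B_{(0,\infty)}$ is the Borel $\sigma$-field on $(0,\infty)$), symmetric ($p_t(x,y)=p_t(y,x)$), satisfies the Chapman–Kolmogorov equations $\int_X p_s(x,y)p_t(y,z)\,m(dy)=p_{s+t}(x,z)$ for all $x,z\in X$, $s,t>0$, and is Markovian: $\int_X p_t(x,y)\,m(dy)\le1$ for all $t>0$, $x\in X$. $f:\mathbb R\to[0,\infty)$ is non-decreasing with $f=0$ on $(-\infty,0]$; $f'\ge 0$ denotes its almost-everywhere derivative. $\mu$ is a nonnegative $\sigma$-finite measure on $(X,\mathcal M)$. Put $$p_s\mu(x)=\int_X p_s(x,y)\,\mu(dy),\qquad h(x)=\int_0^\infty f(s)\,p_s\mu(x)\,ds .$$ Define $q:X\to[0,\infty]$ by $q(x)=0$ if $h(x)=0$ or $h(x)=\infty$, and otherwise $q(x)=\frac1{h(x)}\int_0^\infty f'(s)\,p_s\mu(x)\,ds$. $L^2(m)$ is the space of real-valued square-integrable $\mathcal M$-measurable functions on $X$ with $\langle u,v\rangle=\int_X uv\,dm$, and $p_tu(x)=\int_Xp_t(x,y)u(y)\,m(dy)$, which defines a semigroup of self-adjoint contractions on $L^2(m)$. For $u\in L^2(m)$, $\mathcal E^{(t)}(u,u)=\frac1t\langle u-p_tu,u\rangle$ is nonnegative and nonincreasing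 in $t>0$, and the quadratic form of $p$ is $\mathcal E(u,u)=\lim_{t\to0}\mathcal E^{(t)}(u,u)\in[0,\infty]$. Convention: $u(x)/h(x)=0$ if $h(x)=0$ or $h(x)=\infty$.
   Formalization: In (ii), u is also required to vanish on {h=0 or h=∞} (false otherwise: μ=0, one-point X, p_t=e^{-t}), and β=0 is in effect excluded: t_+^0 is read as 1, against f=0 on (-∞,0]; with f=1 on (0,∞) only, the claim fails for one-point X, m=μ=δ, p_t=e^{-t}. *)

(* Defs.v *)
From HB Require Import structures.
From mathcomp Require Import all_boot all_order all_algebra.
From mathcomp Require Import all_classical all_reals all_analysis.
From mathcomp Require Import measurable_realfun.
Set Implicit Arguments.
Unset Strict Implicit.
Unset Printing Implicit Defensive.
Import Order.TTheory GRing.Theory Num.Theory.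
Import numFieldNormedType.Exports.

Local Open Scope classical_set_scope.
Local Open Scope ring_scope.
Local Open Scope ereal_scope.

(* Only the values of [p t] for [t > 0] are meaningful.  The product
   sigma-algebra on [measurableTypeR R * X * X] is restricted to t > 0. *)
Record transition_density (R : realType) (d : measure_display)
    (X : measurableType d) (m : {measure set X -> \bar R})
    (p : R -> X -> X -> \bar R) : Prop := TransitionDensity {
  density_measurable :
    measurable_fun [set z : measurableTypeR R * X * X | (0 < z.1.1)%R]
      (fun z : measurableTypeR R * X * X => p z.1.1 z.1.2 z.2) ;
  density_ge0 : forall (t : R) (x y : X), (0 < t)%R -> 0 <= p t x y ;
  density_sym : forall (t : R) (x y : X), (0 < t)%R -> p t x y = p t y x ;
  density_chapman_kolmogorov : forall (s t : R) (x z : X),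
    (0 < s)%R -> (0 < t)%R -> \int[m]_y (p s x y * p t y z) = p (s + t)%R x z ;
  density_markov : forall (t : R) (x : X),
    (0 < t)%R -> \int[m]_y p t x y <= 1 }.

Definition density_measure (R : realType) (d : measure_display)
    (X : measurableType d) (p : R -> X -> X -> \bar R)
    (mu : {measure set X -> \bar R}) (s : R) (x : X) : \bar R :=
  \int[mu]_y p s x y.

Definition density_fun (R : realType) (d : measure_display)
    (X : measurableType d) (m : {measure set X -> \bar R})
    (p : R -> X -> X -> \bar R) (t : R) (u : X -> R) (x : X) : \bar R :=
  \int[m]_y (p t x y * (u y)%:E).

Definition hardy_h (R : realType) (d : measure_display)
    (X : measurableType d) (p : R -> X -> X -> \bar R) (f : R -> R)
    (mu : {measure set X -> \bar R}) (x : X) : \bar R :=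
  \int[lebesgue_measure]_(s in `]0%R, +oo[)
     ((f s)%:E * density_measure p mu s x).

(* Where the monotone function [f] is not derivable, which happens on a
   Lebesgue-null set only, [derive1 f] takes the default value of [lim],
   which is 0 in [R]. *)
Definition hardy_q (R : realType) (d : measure_display)
    (X : measurableType d) (p : R -> X -> X -> \bar R) (f : R -> R)
    (mu : {measure set X -> \bar R}) (x : X) : \bar R :=
  let hx := hardy_h p f mu x in
  if (hx == 0) || (hx == +oo) then 0
  else (fine hx)^-1%:E *
       \int[lebesgue_measure]_(s in `]0%R, +oo[)
          ((derive1 f s)%:E * density_measure p mu s x).

Definition h_ratio (R : realType) (X : Type) (u : X -> R) (h : X -> \bar R)
    (x : X) : R :=
  if (h x == 0) || (h x == +oo) then 0%R else (u x / fine (h x))%R.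

Definition approx_form (R : realType) (d : measure_display)
    (X : measurableType d) (m : {measure set X -> \bar R})
    (p : R -> X -> X -> \bar R) (u : X -> R) (t : R) : \bar R :=
  t^-1%:E * \int[m]_x (((u x)%:E - density_fun m p t u x) * (u x)%:E).

Definition quad_form (R : realType) (d : measure_display)
    (X : measurableType d) (m : {measure set X -> \bar R})
    (p : R -> X -> X -> \bar R) (u : X -> R) : \bar R :=
  lim (approx_form m p u t @[t --> 0%R^'+]).

(* Products in [\bar R] satisfy [0 * +oo = 0], so pairs with
   [h x = +oo] or [h y = +oo] and equal ratios contribute nothing. *)
Definition remainder_form (R : realType) (d : measure_display)
    (X : measurableType d) (m : {measure set X -> \bar R})
    (p : R -> X -> X -> \bar R) (h : X -> \bar R) (u : X -> R) (t : R)
    : \bar R :=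
  \int[m]_x \int[m]_y
     (p t x y * (2 * t)^-1%:E * ((h_ratio u h x - h_ratio u h y) ^+ 2)%:E
      * h y * h x).

(* Absolute continuity on every compact interval: t_+^beta with beta > 1 is
   not absolutely continuous uniformly on the whole line. *)
Definition absolutely_continuous_fun (R : realType) (f : R -> R) : Prop :=
  forall a b : R, forall e : R, (0 < e)%R -> exists2 del : R, (0 < del)%R &
  forall (n : nat) (l r : 'I_n -> R),
    (forall i, (a <= l i)%R /\ (l i <= r i)%R /\ (r i <= b)%R) ->
    trivIset [set: 'I_n] (fun i => `]l i, r i[%classic) ->
    (\sum_(i < n) (r i - l i) < del)%R ->
    (\sum_(i < n) `|f (r i) - f (l i)| < e)%R.

(* [powR] has 0 `^ 0 = 1: for [beta = 0] this is f = 1 on the whole line,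
   which is incompatible with f = 0 on ]-oo, 0]. *)
Definition power_profile (R : realType) (f : R -> R) : Prop :=
  exists2 beta : R, (0 <= beta)%R & forall t : R, f t = (Num.max t 0 `^ beta)%R.

(* The inequality is required wherever f'(s) exists. *)
Definition slope_bound (R : realType) (f : R -> R) : Prop :=
  exists del c : R, (0 < del)%R /\
    forall s t : R, (0 < s)%R -> derivable f s 1 -> (0 < t)%R -> (t < del)%R ->
      ((f s - f (s - t)) / t <= c * derive1 f s)%R.

(* Main.v *)
(** Write N = |u|^2, phi(t) = <p_t u, u>, r = u^2 / h and beta(t) = <r, p_t h>.
    Expanding the square gives E^(t) = (N - phi(t)) / t, the remainder form is
    J_t = (beta(t) - phi(t)) / t, and
    (N - beta(t)) / t = \int r (x) \int (f(s) - f(s - t)) / t p_s mu(x) ds m(dx),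
    because h - p_t h = \int (f(s) - f(s - t)) p_s mu ds.  Fatou's lemma bounds
    the lower limit of the last quantity below by \int u^2 q dm; under the slope
    bound, dominated convergence makes it an equality.

    It remains that E^(t) and J_t converge in [0, +oo], also when \int u^2 q dm
    is infinite and J_t is not the difference of two finite limits.  Both have
    the form D(t) / t with D(2nt) <= 2n D(t), and D is suitably semicontinuous
    because phi is midpoint convex and beta is monotone; this forces D(t) / t to
    converge to its supremum.  The inequality for D = beta - phi comes from
    S = p_t + (h - p_t h) / h, a symmetric positive operator with S h = h where
    0 < h < +oo: D is the conservative form of S, whose powers dominate those of
    p_t, and <(1 - S^(2n)) u, u> <= 2n <(1 - S) u, u> by expanding
    |S^j u - S^l u|^2 >= 0. *)
Require Import Defs.
From HB Require Import structures.
From mathcomp Require Import all_boot all_order all_algebra.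
From mathcomp Require Import all_classical all_reals all_analysis.
From mathcomp Require Import measurable_realfun.
From mathcomp Require Import ring lra zify.
Set Implicit Arguments.
Unset Strict Implicit.
Unset Printing Implicit Defensive.
Import Order.TTheory GRing.Theory Num.Theory.
Import numFieldNormedType.Exports.

Local Open Scope classical_set_scope.
Local Open Scope ring_scope.
Local Open Scope ereal_scope.

(** The obstacle throughout is subtraction: [h] and p_t h may be infinite and u is signed. Operators
    therefore act only on [[0, +oo]]-valued functions, u enters as a pair of nonnegative functions,
    and every identity is arranged as an equality of sums of nonnegative terms; one subtracts only
    after integrating, between finite numbers. The finiteness comes from Schur's test with weight
    [h]: since 2|u(x)u(y)| <= h(x)r(y) + r(x)h(y), the bound p_t h <= h already gives <p_t |u|, |u|>
    <= |u|^2, and the same argument covers S.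

    The operator S depends on t and is not a semigroup in t, so J_t is compared only along multiples
    of one t. The multiples are even because <S^k u, u> is visibly a square only for even k: a
    symmetric positivity preserving operator need not be positive definite. The even multiple of t
    nearest below a given T misses T by less than 2t, and semicontinuity from the left absorbs this
    gap. *)

(** * Convergence of D(t) / t as t decreases to 0 *)

Section scaling_limit.
Variable R : realType.
Local Open Scope ring_scope.

(** If [phi] gained more than [e] on the step from [T] down to [s], midpoint convexity would force a
    gain of more than [e] on each further step of the progression T - k (T - s), and the bound [C]
    would eventually be violated. *)
Lemma midpoint_convex_left_usc (phi : R -> R) (C : R) :
  (forall s r : R, 0 < s -> 0 < r -> 2 * phi (s + r) <= phi (2 * s) + phi (2 * r)) ->
  (forall s : R, 0 < s -> `|phi s| <= C) ->
  forall T e : R, 0 < T -> 0 < e ->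
  exists2 del, 0 < del & forall s, T - del < s -> s <= T -> phi s <= phi T + e.
Proof.
move=> cvx bnd T e T0 e0.
have C0 : 0 <= C by apply: le_trans (bnd _ T0).
(* [K] gains of size [e] exceed 2C, the largest possible oscillation; steps shorter than T / K keep
   all [K] points positive. *)
pose K := (Num.truncn (2 * C / e)).+1.
have K0 : 0 < K%:R :> R by rewrite ltr0n.
have KC : 2 * C < K%:R * e.
  rewrite -ltr_pdivrMr//; apply: truncnS_gt.
exists (T / K%:R); first exact: divr_gt0.
move=> s sT sT'; rewrite leNgt; apply/negP => abs.
pose x k := phi (T - k%:R * (T - s)).
have pos k : (k <= K)%N -> 0 < T - k%:R * (T - s).
  move=> kK; rewrite subr_gt0.
  have [->|sT2] := eqVneq s T; first by rewrite subrr mulr0.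
  have sT3 : 0 < T - s by rewrite subr_gt0 lt_neqAle sT2.
  apply: (@le_lt_trans _ _ (K%:R * (T - s))).
    by rewrite ler_pM2r// ler_nat.
  by rewrite mulrC -ltr_pdivlMr//; lra.
have step k : (k < K)%N -> e < x k.+1 - x k.
  elim: k => [_|k IH kK].
    have -> : x 0%N = phi T by rewrite /x mul0r subr0.
    have -> : x 1%N = phi s by rewrite /x mul1r opprB addrC subrK.
    lra.
  have := IH (ltnW kK).
  have h2 : (0 : R) < 2^-1 by rewrite invr_gt0.
  have := cvx ((T - k%:R * (T - s)) / 2) ((T - k.+2%:R * (T - s)) / 2)
    (mulr_gt0 (pos _ (ltnW (ltnW kK))) h2) (mulr_gt0 (pos _ kK) h2).
  have -> : 2 * ((T - k%:R * (T - s)) / 2) = T - k%:R * (T - s) by field.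
  have -> : 2 * ((T - k.+2%:R * (T - s)) / 2) = T - k.+2%:R * (T - s) by field.
  have -> : (T - k%:R * (T - s)) / 2 + (T - k.+2%:R * (T - s)) / 2
          = T - k.+1%:R * (T - s).
    by rewrite -!natr1; field.
  rewrite -/(x k) -/(x k.+1) -/(x k.+2); lra.
have grow k : (k <= K)%N -> k%:R * e <= x k - x 0%N.
  elim: k => [_|k IH kK]; first by rewrite mul0r subrr.
  have := IH (ltnW kK); have := step _ kK; rewrite -natr1; lra.
have := grow _ (leqnn K).
have := bnd _ (pos _ (leqnn K)); have := bnd _ (pos _ (leq0n K)).
rewrite -/(x K) -/(x 0%N) !ler_norml => /andP[? ?] /andP[? ?]; lra.
Qed.

(** A value M below the supremum is exceeded by D(T) / T for some T. For small t and the largest n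
    with 2nt <= T, D(T) <= D(2nt) + e <= 2n D(t) + e <= (T / t) D(t) + e, so D(t) / t exceeds M as
    well. *)
Lemma cvg_rate_at0 (D : R -> R) :
  (forall t : R, 0 < t -> 0 <= D t) ->
  (forall (n : nat) (t : R), (0 < n)%N -> 0 < t -> D ((2 * n)%:R * t) <= (2 * n)%:R * D t) ->
  (forall T e : R, 0 < T -> 0 < e ->
    exists2 del, 0 < del & forall s, T - del < s -> s <= T -> D T <= D s + e) ->
  (D t / t)%:E @[t --> 0%R^'+] -->
    ereal_sup [set (D t / t)%:E | t in [set t | 0 < t]].
Proof.
move=> D0 Dn Dl; set L := ereal_sup _.
have key (M : R) : (M%:E < L)%E ->
    \forall t \near 0%R^'+, (M%:E < (D t / t)%:E)%E.
  move=> /ereal_sup_gt[_ [T /= T0 <-]]; rewrite lte_fin => MT.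
  have MT' : M * T < D T by rewrite -ltr_pdivlMr.
  (* Half of the excess of D(T) over MT is spent on semicontinuity; the other half keeps the final
     inequality strict. *)
  have e0 : 0 < (D T - M * T) / 2 by lra.
  have [del del0 Ddel] := Dl T _ T0 e0.
  have d2 : 0 < del / 2 by lra.
  have T2 : 0 < T / 2 by lra.
  have Mn : 0 < (D T - M * T) / (2 * (`|M| + 1)).
    by apply: divr_gt0; [lra|apply: mulr_gt0 => //; exact: ltr_wpDl].
  near=> t; rewrite lte_fin.
  have t0 : 0 < t by near: t; exact: nbhs_right_gt.
  have td : t < del / 2 by near: t; exact: nbhs_right_lt.
  have tT : t < T / 2 by near: t; exact: nbhs_right_lt.
  (* Then T - 2t < 2nt <= T; the choice of t below [del / 2] puts 2nt in the window of
     semicontinuity, and t below T / 2 makes n positive. *)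
  pose n := Num.truncn (T / (2 * t)).
  have tt0 : 0 < 2 * t by lra.
  have Tt0 : 0 <= T / (2 * t) by apply: divr_ge0; exact: ltW.
  have := truncn_itv Tt0; rewrite -/n => /andP[n1 n2].
  have n0 : (0 < n)%N.
    rewrite lt0n; apply/eqP => n0; move: n2; rewrite n0 ltr_pdivrMr//; lra.
  have nT : (2 * n)%:R * t <= T.
    by move: n1; rewrite ler_pdivlMr// natrM; lra.
  have Tn : T - 2 * t < (2 * n)%:R * t.
    by move: n2; rewrite ltr_pdivrMr// -natr1 natrM; lra.
  have DT : D T <= D ((2 * n)%:R * t) + (D T - M * T) / 2 by apply: Ddel => //; lra.
  have Dnt := Dn n t n0 t0.
  have Dt0 := D0 _ t0.
  have : (2 * n)%:R * D t <= T / t * D t.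
    by apply: ler_wpM2r => //; rewrite ler_pdivlMr.
  have -> : T / t * D t = T * (D t / t) by field; apply: lt0r_neq0.
  move=> le.
  have : M * T < T * (D t / t) by lra.
  by rewrite mulrC ltr_pM2l.
have ub t : 0 < t -> ((D t / t)%:E <= L)%E.
  by move=> t0; apply: ereal_sup_ubound; exists t.
have L0 : (0%:E <= L)%E.
  by apply: le_trans (ub 1 ltr01); rewrite lee_fin divr1; apply: D0.
case: L L0 key ub => [l| |//] L0 key ub; last first.
  apply/cvgeyPgt => M; apply: key; exact: ltry.
apply/fine_cvgP; split; first by apply: nearW.
apply/cvgrPdist_le => e e0.
have := key (l - e); rewrite lte_fin => /(_ ltac:(lra)) lek.
near=> t.
have t0 : 0 < t by near: t; exact: nbhs_right_gt.
have := ub _ t0; rewrite lee_fin => u1.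
have : ((l - e)%:E < (D t / t)%:E)%E by near: t; exact: lek.
rewrite lte_fin /= ler_norml => u2; apply/andP; split; lra.
Unshelve. all: by end_near. Qed.

End scaling_limit.

(** * Nonnegative measurable functions and their pairing *)

Definition nnmeas d (X : measurableType d) (R : realType) (f : X -> \bar R) :=
  measurable_fun [set: X] f /\ forall x, 0 <= f x.

Section nnmeas.
Context d (X : measurableType d) (R : realType).
Implicit Types a b : X -> \bar R.

Lemma nnmeasD a b : nnmeas a -> nnmeas b -> nnmeas (fun x => a x + b x).
Proof.
by move=> [ma a0] [mb b0]; split=> [|x]; [exact: emeasurable_funD|exact: adde_ge0].
Qed.

Lemma nnmeasM a b : nnmeas a -> nnmeas b -> nnmeas (fun x => a x * b x).
Proof.
by move=> [ma a0] [mb b0]; split=> [|x]; [exact: emeasurable_funM|exact: mule_ge0].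
Qed.

Lemma nnmeas_cst (c : \bar R) : 0 <= c -> nnmeas (fun _ : X => c).
Proof. by move=> c0; split=> //. Qed.

Lemma nnmeasZ (c : \bar R) a : 0 <= c -> nnmeas a -> nnmeas (fun x => c * a x).
Proof. by move=> c0; apply: nnmeasM; exact: nnmeas_cst. Qed.

Lemma nnmeas_integral d' (Y : measurableType d')
    (mu : {sigma_finite_measure set Y -> \bar R}) (F : X * Y -> \bar R) :
  nnmeas F -> nnmeas (fun x => \int[mu]_y F (x, y)).
Proof.
move=> [mF F0]; split=> [|x]; first exact: measurable_fun_fubini_tonelli_F.
exact: integral_ge0.
Qed.

Lemma nnmeas_comp d' (Y : measurableType d') (g : Y -> X) a :
  measurable_fun [set: Y] g -> nnmeas a -> nnmeas (fun y => a (g y)).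
Proof. by move=> mg [ma a0]; split=> //; exact: measurableT_comp. Qed.

End nnmeas.

Section pairing.
Context d (X : measurableType d) (R : realType).
Variable m : {measure set X -> \bar R}.
Implicit Types a b c : X -> \bar R.

Definition pairing a b := \int[m]_x (a x * b x).

Lemma pairing_ge0 a b : nnmeas a -> nnmeas b -> 0 <= pairing a b.
Proof. by move=> [_ a0] [_ b0]; apply: integral_ge0 => x _; exact: mule_ge0. Qed.

Lemma pairingC a b : pairing a b = pairing b a.
Proof. by apply: eq_integral => x _; rewrite muleC. Qed.

Lemma pairingDr a b c : nnmeas a -> nnmeas b -> nnmeas c ->
  pairing a (fun x => b x + c x) = pairing a b + pairing a c.
Proof.
move=> na nb nc; rewrite /pairing -ge0_integralD//.
- by apply: eq_integral => x _; rewrite ge0_muleDr //; [case: nb|case: nc].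
- by move=> x _; case: (nnmeasM na nb).
- by case: (nnmeasM na nb).
- by move=> x _; case: (nnmeasM na nc).
- by case: (nnmeasM na nc).
Qed.

Lemma pairingDl a b c : nnmeas a -> nnmeas b -> nnmeas c ->
  pairing (fun x => a x + b x) c = pairing a c + pairing b c.
Proof. by move=> na nb nc; rewrite pairingC pairingDr// !(pairingC c). Qed.

Lemma nn_integralD a b : nnmeas a -> nnmeas b ->
  \int[m]_x (a x + b x) = \int[m]_x a x + \int[m]_x b x.
Proof. by move=> [ma a0] [mb b0]; rewrite ge0_integralD. Qed.

Lemma nn_integralZl (k : \bar R) a : 0 <= k -> nnmeas a ->
  \int[m]_x (k * a x) = k * \int[m]_x a x.
Proof. by move=> k0 [ma a0]; rewrite ge0_integralZl. Qed.

Lemma nn_le_integral a b : nnmeas a -> nnmeas b -> (forall x, a x <= b x) ->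
  \int[m]_x a x <= \int[m]_x b x.
Proof. by move=> [ma a0] [mb b0] ab; apply: ge0_le_integral. Qed.

Lemma le_pairing a a' b b' : nnmeas a -> nnmeas a' -> nnmeas b -> nnmeas b' ->
  (forall x, a x <= a' x) -> (forall x, b x <= b' x) ->
  pairing a b <= pairing a' b'.
Proof.
move=> na na' nb nb' aa bb; apply: nn_le_integral; [exact: nnmeasM..|] => x.
by apply: lee_pmul => //; [case: na|case: nb].
Qed.

End pairing.

(** * Symmetric positive operators on nonnegative functions *)

Record symmetric_positive d (X : measurableType d) (R : realType)
    (m : {measure set X -> \bar R}) (S : (X -> \bar R) -> X -> \bar R) : Prop :=
  SymmetricPositive {
  sp_nnmeas : forall a, nnmeas a -> nnmeas (S a) ;
  sp_add : forall a b, nnmeas a -> nnmeas b ->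
    S (fun x => a x + b x) = (fun x => S a x + S b x) ;
  sp_scale : forall k a, 0 <= k -> nnmeas a ->
    S (fun x => k * a x) = (fun x => k * S a x) ;
  sp_le : forall a b, nnmeas a -> nnmeas b -> (forall x, a x <= b x) ->
    forall x, S a x <= S b x ;
  sp_sym : forall a b, nnmeas a -> nnmeas b ->
    pairing m (S a) b = pairing m a (S b) }.

Section symmetric_positive_theory.
Context d (X : measurableType d) (R : realType).
Variable m : {measure set X -> \bar R}.
Implicit Types (a b : X -> \bar R) (S T : (X -> \bar R) -> X -> \bar R).

Lemma sp_addE S a b x : symmetric_positive m S -> nnmeas a -> nnmeas b ->
  S (fun y => a y + b y) x = S a x + S b x.
Proof. by move=> spS na nb; rewrite (sp_add spS). Qed.

Lemma sp_scaleE S k a x : symmetric_positive m S -> 0 <= k -> nnmeas a ->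
  S (fun y => k * a y) x = k * S a x.
Proof. by move=> spS k0 na; rewrite (sp_scale spS). Qed.

Lemma symmetric_positive_id : symmetric_positive m (fun a => a).
Proof. by split. Qed.

(** Commutation is what makes the composite symmetric: <STa, b> = <Ta, Sb> = <a, TSb> = <a, STb>. *)
Lemma symmetric_positive_comp S T :
  (forall a, nnmeas a -> S (T a) = T (S a)) ->
  symmetric_positive m S -> symmetric_positive m T ->
  symmetric_positive m (fun a => S (T a)).
Proof.
move=> ST spS spT; have nT := sp_nnmeas spT; have nS := sp_nnmeas spS.
split.
- by move=> a na; apply: nS; apply: nT.
- by move=> a b na nb; rewrite (sp_add spT)// (sp_add spS)//; exact: nT.
- by move=> k a k0 na; rewrite (sp_scale spT)// (sp_scale spS)//; exact: nT.
- move=> a b na nb ab; apply: (sp_le spS); [exact: nT..|exact: (sp_le spT)].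
- move=> a b na nb; rewrite (sp_sym spS)//; last exact: nT.
  by rewrite (sp_sym spT)// ?ST//; exact: nS.
Qed.

Lemma symmetric_positive_iter n S :
  symmetric_positive m S -> symmetric_positive m (iter n S).
Proof.
move=> spS; elim: n => [|n IH]; first exact: symmetric_positive_id.
by apply: (symmetric_positive_comp _ spS IH) => a _; exact: iterSr.
Qed.

Lemma le_iter S T n : symmetric_positive m S -> symmetric_positive m T ->
  (forall a, nnmeas a -> forall x, S a x <= T a x) ->
  forall a, nnmeas a -> forall x, iter n S a x <= iter n T a x.
Proof.
move=> spS spT ST a na; elim: n => [//|n IH] x /=.
have nn U : symmetric_positive m U -> nnmeas (iter n U a).
  by move=> spU; apply: (sp_nnmeas (symmetric_positive_iter n spU)).
apply: le_trans (ST _ (nn _ spT) x); apply: (sp_le spS) => //; exact: nn.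
Qed.

(** With kappa = (h - p_t h) / h this produces the operator that restores the mass of [h] lost by
    p_t. *)
Lemma symmetric_positive_addM S kappa : nnmeas kappa ->
  symmetric_positive m S ->
  symmetric_positive m (fun a x => S a x + kappa x * a x).
Proof.
move=> nk spS; have nS := sp_nnmeas spS; split.
- by move=> a na; apply: nnmeasD; [exact: nS|exact: nnmeasM].
- move=> a b na nb; apply/funext => x; rewrite (sp_add spS)//.
  by rewrite ge0_muleDr; [rewrite addeACA|case: na|case: nb].
- move=> k a k0 na; apply/funext => x; rewrite (sp_scale spS)//.
  rewrite ge0_muleDr; [by rewrite muleCA|by case: (nS _ na)|].
  by case: (nnmeasM nk na).
- move=> a b na nb ab x; apply: leeD; first exact: (sp_le spS).
  by apply: lee_wpmul2l => //; case: nk.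
- move=> a b na nb; have n1 := nnmeasM nk na; have n2 := nnmeasM nk nb.
  rewrite pairingDl ?pairingDr//; [|exact: nS..].
  congr (_ + _); first exact: (sp_sym spS).
  by apply: eq_integral => x _; rewrite -muleA muleCA.
Qed.

End symmetric_positive_theory.

Definition kernel_op d (X : measurableType d) (R : realType)
    (m : {measure set X -> \bar R}) (k : X -> X -> \bar R)
    (a : X -> \bar R) (x : X) : \bar R := \int[m]_y (k x y * a y).

Section kernel_op.
Context d (X : measurableType d) (R : realType).
Variable m : {sigma_finite_measure set X -> \bar R}.
Variable k : X -> X -> \bar R.
Hypothesis nk : nnmeas (fun z : X * X => k z.1 z.2).
Hypothesis symk : forall x y, k x y = k y x.

Let nk1 x : nnmeas (k x).
Proof. exact: (nnmeas_comp (measurable_pair1 x) nk). Qed.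

Lemma symmetric_positive_kernel_op : symmetric_positive m (kernel_op m k).
Proof.
have n2 a : nnmeas a -> nnmeas (fun z : X * X => k z.1 z.2 * a z.2).
  by move=> na; apply: nnmeasM => //; exact: nnmeas_comp na.
split.
- by move=> a na; exact: (nnmeas_integral m (n2 _ na)).
- move=> a b na nb; apply/funext => x; rewrite /kernel_op.
  rewrite -nn_integralD; [|exact: nnmeasM..].
  by apply: eq_integral => y _; rewrite ge0_muleDr//; [case: na|case: nb].
- move=> c a c0 na; apply/funext => x; rewrite /kernel_op.
  rewrite -nn_integralZl//; last exact: nnmeasM.
  by apply: eq_integral => y _; rewrite muleCA.
- move=> a b na nb ab x; apply: nn_le_integral; [exact: nnmeasM..|] => y.
  by apply: lee_wpmul2l => //; case: (nk1 x).
- move=> a b na nb; rewrite /pairing /kernel_op.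
  have nF : nnmeas (fun z : X * X => b z.1 * (k z.1 z.2 * a z.2)).
    by apply: nnmeasM (n2 _ na); exact: nnmeas_comp nb.
  transitivity (\int[m]_x \int[m]_y (b x * (k x y * a y))).
    apply: eq_integral => x _; rewrite muleC -nn_integralZl//.
      by case: nb.
    exact: nnmeasM.
  case: nF => mF F0.
  rewrite (fubini_tonelli (fun z : X * X => b z.1 * (k z.1 z.2 * a z.2)))//=.
  apply: eq_integral => y _.
  have [_ a0] := na.
  rewrite -nn_integralZl; [|exact: a0|exact: nnmeasM].
  apply: eq_integral => x _; by rewrite (symk y x) muleA muleC (muleC (b x)).
Qed.

End kernel_op.

Lemma mule_AMGM (R : realType) (x y : \bar R) : 0 <= x -> 0 <= y ->
  x * y + x * y <= x * x + y * y.
Proof.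
case: x => [x| |//]; case: y => [y| |//] x0 y0.
- by rewrite -!EFinM -!EFinD lee_fin; have := sqr_ge0 (x - y)%R; rewrite expr2; lra.
- by rewrite mulyy addey ?leey// -EFinM.
- by rewrite mulyy addye ?leey// -EFinM.
- by rewrite mulyy.
Qed.

(** * Quadratic forms of a signed function, given by its two nonnegative parts *)

Section signed_form.
Context d (X : measurableType d) (R : realType).
Variable m : {measure set X -> \bar R}.
Variables a b h r : X -> \bar R.
Hypotheses (na : nnmeas a) (nb : nnmeas b) (nh : nnmeas h) (nr : nnmeas r).
Hypothesis dom : forall x y,
  (a x + b x) * (a y + b y) + (a x + b x) * (a y + b y) <= h x * r y + r x * h y.
Hypothesis hr_lty : pairing m h r < +oo.

Implicit Types A B S T : (X -> \bar R) -> X -> \bar R.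

(** In potential theory [h] is called excessive for T; here [h] is fixed and T varies, so the
    property is attached to T. *)
Definition excessive T := symmetric_positive m T /\ forall x, T h x <= h x.

(* The quadratic form of T at the signed function a - b, computed without
   ever applying T to a signed function. *)
Definition signed_form T : R :=
  (fine (pairing m a (T a)) + fine (pairing m b (T b))
   - 2 * fine (pairing m a (T b)))%R.

Lemma excessive_id : excessive (fun w => w).
Proof. by split; [exact: symmetric_positive_id|]. Qed.

Lemma excessive_comp S T : (forall w, nnmeas w -> S (T w) = T (S w)) ->
  excessive S -> excessive T -> excessive (fun w => S (T w)).
Proof.
move=> ST [spS Sh] [spT Th]; split; first exact: symmetric_positive_comp.
move=> x; apply: le_trans (Sh x).
by apply: (sp_le spS) => //; exact: (sp_nnmeas spT).
Qed.

Lemma excessive_iter n S : excessive S -> excessive (iter n S).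
Proof.
move=> exS; elim: n => [|n IH]; first exact: excessive_id.
by apply: (excessive_comp _ exS IH) => w _; exact: iterSr.
Qed.

Let c x := a x + b x.
Let nc : nnmeas c. Proof. exact: nnmeasD. Qed.

(** Schur's test: applying T to [dom] in the second variable and integrating in the first bounds
    2<c, Tc> by <h, Tr> + <r, Th>, and by symmetry both terms are at most <h, r>. *)
Let schur T : excessive T -> pairing m c (T c) <= pairing m h r.
Proof.
move=> [spT Th]; have nT := sp_nnmeas spT; have [_ c0] := nc.
have [[_ h0] [_ r0]] := (nh, nr).
have twice (z : \bar R) : z + z = 2%:E * z.
  by rewrite -mule2n -mule_natl.
rewrite -(@lee_pmul2l _ 2%:E)// -!twice.
apply: (@le_trans _ _ (pairing m h (T r) + pairing m r (T h))); last first.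
  have nTh := nT _ nh; apply: leeD; last first.
    by rewrite [leRHS]pairingC; apply: le_pairing.
  by rewrite -(sp_sym spT)//; apply: le_pairing.
have nac : nnmeas (fun x => c x * T c x) by apply: nnmeasM => //; exact: nT.
have n1 : nnmeas (fun x => h x * T r x) by apply: nnmeasM => //; exact: nT.
have n2 : nnmeas (fun x => r x * T h x) by apply: nnmeasM => //; exact: nT.
rewrite /pairing -!nn_integralD//; apply: nn_le_integral; [exact: nnmeasD..|].
move=> x; have n3 := nnmeasZ (h0 x) nr; have n4 := nnmeasZ (r0 x) nh.
have c2 : 0 <= 2%:E * c x by rewrite mule_ge0.
(* With x frozen, the factors depending on x move inside T, where monotonicity can be applied to
   [dom]. *)
rewrite twice muleA -(sp_scaleE x spT c2)// -(sp_scaleE x spT (h0 x))//.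
rewrite -(sp_scaleE x spT (r0 x))// -(sp_addE x spT n3 n4).
apply: (sp_le spT); [|exact: nnmeasD|].
  exact: nnmeasZ.
by move=> y; rewrite -muleA -twice; exact: dom.
Qed.

Let fin T v w : nnmeas v -> nnmeas w -> (forall x, v x <= c x) ->
  (forall x, w x <= c x) -> excessive T -> pairing m v (T w) \is a fin_num.
Proof.
move=> nv nw vc wc exT; have [spT _] := exT; have nT := sp_nnmeas spT.
rewrite ge0_fin_numE; last by apply: pairing_ge0 => //; exact: nT.
apply: (le_lt_trans _ hr_lty); apply: le_trans (schur exT).
by apply: le_pairing => //; [exact: nT|exact: nT|exact: (sp_le spT)].
Qed.

Let ac x : a x <= c x. Proof. by rewrite leeDl//; case: nb. Qed.
Let bc x : b x <= c x. Proof. by rewrite leeDr//; case: na. Qed.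

Lemma pairing_fin_num T : excessive T ->
  [/\ pairing m a (T a) \is a fin_num, pairing m b (T b) \is a fin_num &
      pairing m a (T b) \is a fin_num].
Proof. by move=> exT; split; exact: fin. Qed.

Lemma pairing_excessiveC T : excessive T ->
  pairing m b (T a) = pairing m a (T b).
Proof. by move=> [spT _]; rewrite pairingC; exact: (sp_sym spT). Qed.

(** The Schur bound for a + b expands to A + B + 2C with nonnegative terms, which dominates |A + B -
    2C|. *)
Lemma signed_form_bound T : excessive T ->
  (`|signed_form T| <= fine (pairing m h r))%R.
Proof.
move=> exT; have := schur exT; have [spT _] := exT; have nT := sp_nnmeas spT.
rewrite {2}/c (sp_add spT)// pairingDr//; [|exact: nT..].
rewrite !pairingDl//; [|exact: nT..].
rewrite (pairing_excessiveC exT).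
have [f1 f2 f3] := pairing_fin_num exT.
have hrf : pairing m h r \is a fin_num.
  by rewrite ge0_fin_numE//; exact: pairing_ge0.
have p1 : 0 <= pairing m a (T a) by apply: pairing_ge0 => //; exact: nT.
have p2 : 0 <= pairing m b (T b) by apply: pairing_ge0 => //; exact: nT.
have p3 : 0 <= pairing m a (T b) by apply: pairing_ge0 => //; exact: nT.
move: p1 p2 p3; rewrite /signed_form.
rewrite -(fineK f1) -(fineK f2) -(fineK f3) -(fineK hrf) -!EFinD !lee_fin /=.
by move=> p1 p2 p3 le; rewrite ler_norml; apply/andP; split; lra.
Qed.

(** This is |Au - Bu|^2 >= 0 for u = a - b. The products are separate parameters because p_s p_t and
    p_(s+t) agree only on nonnegative measurable functions. *)
Lemma signed_form_convex A B AA BB AB :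
  excessive A -> excessive B -> excessive AA -> excessive BB -> excessive AB ->
  (forall w, nnmeas w -> A (A w) = AA w) ->
  (forall w, nnmeas w -> B (B w) = BB w) ->
  (forall w, nnmeas w -> A (B w) = AB w) ->
  (forall w, nnmeas w -> B (A w) = AB w) ->
  (2 * signed_form AB <= signed_form AA + signed_form BB)%R.
Proof.
move=> exA exB exAA exBB exAB AAE BBE ABE BAE.
have [[spA _] [spB _]] := (exA, exB).
have nA := sp_nnmeas spA; have nB := sp_nnmeas spB.
(* Formally al - be = (A - B)(a - b), so 2 al be <= al^2 + be^2 is the desired square without a
   subtraction. *)
pose al x := A a x + B b x; pose be x := A b x + B a x.
have nal : nnmeas al by apply: nnmeasD; [exact: nA|exact: nB].
have nbe : nnmeas be by apply: nnmeasD; [exact: nA|exact: nB].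
have : pairing m al be + pairing m al be <= pairing m al al + pairing m be be.
  rewrite /pairing -!nn_integralD; [|exact: nnmeasM..].
  apply: nn_le_integral; [by apply: nnmeasD; exact: nnmeasM..|move=> x].
  by apply: mule_AMGM; [case: nal|case: nbe].
have [[nAa nAb] [nBa nBb]] := ((nA _ na, nA _ nb), (nB _ na, nB _ nb)).
rewrite !pairingDl// !pairingDr//.
rewrite !(sp_sym spA)// !(sp_sym spB)// !AAE// !BBE// !ABE// !BAE//.
rewrite ?(pairing_excessiveC exAA) ?(pairing_excessiveC exBB).
rewrite ?(pairing_excessiveC exAB).
have [f1 f2 f3] := pairing_fin_num exAA.
have [g1 g2 g3] := pairing_fin_num exBB.
have [i1 i2 i3] := pairing_fin_num exAB.
rewrite /signed_form.
rewrite -(fineK f1) -(fineK f2) -(fineK f3) -(fineK g1) -(fineK g2) -(fineK g3).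
rewrite -(fineK i1) -(fineK i2) -(fineK i3) -!EFinD !lee_fin /=; lra.
Qed.

(** Convexity makes the drops q(2k) - q(2k + 2) nonincreasing in k, so n of them sum to at most n
    (q(0) - q(2)), and q(0) - q(2) <= 2 (q(0) - q(1)). *)
Lemma signed_form_iter n S : excessive S ->
  (signed_form (fun w => w) - signed_form (iter (2 * n) S)
   <= (2 * n)%:R * (signed_form (fun w => w) - signed_form S))%R.
Proof.
move=> exS; pose q k := signed_form (iter k S).
have ex k : excessive (iter k S) by exact: excessive_iter.
have cvx j l : (2 * q (j + l)%N <= q (j + j)%N + q (l + l)%N)%R.
  apply: (@signed_form_convex (iter j S) (iter l S)) => // w _; rewrite -iterD//.
  by rewrite addnC.
have q01 : (q 0%N - q 2%N <= 2 * (q 0%N - q 1%N))%R.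
  by have := cvx 0%N 1%N; rewrite /=; lra.
have dec k : (q (2 * k)%N - q (2 * k.+1)%N <= q 0%N - q 2%N)%R.
  elim: k => [//|k IH].
  have := cvx k k.+2.
  have -> : (k + k.+2 = 2 * k.+1)%N by lia.
  have -> : (k + k = 2 * k)%N by lia.
  have -> : (k.+2 + k.+2 = 2 * k.+2)%N by lia.
  lra.
rewrite -/(q (2 * n)%N) -/(q 0%N) -[signed_form S]/(q 1%N).
elim: n => [|n IH]; first by rewrite muln0 subrr mul0r.
have := dec n; move: IH; rewrite !natrM -natr1; lra.
Qed.

(** * Comparison of the square forms of two operators *)

Section comparison.
Variable w : X -> X -> \bar R.
Hypothesis nw : forall x, nnmeas (w x).
Hypothesis wE : forall x y,
  w x y + (a x * a y + a x * a y + (b x * b y + b x * b y)) =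
  h x * r y + r x * h y + (a x * b y + a x * b y + (b x * a y + b x * a y)).

Definition mass_form T : R := fine (pairing m r (T h)).

Let pos T x : \bar R :=
  a x * T a x + a x * T a x + (b x * T b x + b x * T b x).
Let mix T x : \bar R :=
  h x * T r x + r x * T h x +
  (a x * T b x + a x * T b x + (b x * T a x + b x * T a x)).

Let npos T : excessive T -> nnmeas (pos T).
Proof.
move=> [spT _]; have nT := sp_nnmeas spT.
by do ?apply: nnmeasD; apply: nnmeasM => //; exact: nT.
Qed.

Let nmix T : excessive T -> nnmeas (mix T).
Proof.
move=> [spT _]; have nT := sp_nnmeas spT.
by do ?apply: nnmeasD; apply: nnmeasM => //; exact: nT.
Qed.

(** T acts on [wE] in the second variable with x frozen, and the result is evaluated at that same
    x. *)
Let mixE T x : excessive T -> T (w x) x + pos T x = mix T x.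
Proof.
move=> [spT _]; have nT := sp_nnmeas spT.
have sc v : nnmeas v -> nnmeas (fun y => v x * v y).
  by move=> nv; apply: nnmeasZ => //; case: nv.
have [[[_ a0] [_ b0]] [[_ h0] [_ r0]]] := ((na, nb), (nh, nr)).
have naa := nnmeasZ (a0 x) na; have nab := nnmeasZ (a0 x) nb.
have nba := nnmeasZ (b0 x) na; have nbb := nnmeasZ (b0 x) nb.
have nhr := nnmeasZ (h0 x) nr; have nrh := nnmeasZ (r0 x) nh.
rewrite /pos /mix.
rewrite -!(sp_scaleE x spT (a0 x))// -!(sp_scaleE x spT (b0 x))//.
rewrite -!(sp_scaleE x spT (h0 x))// -!(sp_scaleE x spT (r0 x))//.
have := congr1 (fun f => T f x) (funext (wE x)).
rewrite (sp_addE x spT (nw x)); last by do ?apply: nnmeasD.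
rewrite (sp_addE x spT (nnmeasD naa naa) (nnmeasD nbb nbb)).
rewrite (sp_addE x spT naa naa) (sp_addE x spT nbb nbb).
rewrite (sp_addE x spT (nnmeasD nhr nrh)); last by do ?apply: nnmeasD.
rewrite (sp_addE x spT nhr nrh).
rewrite (sp_addE x spT (nnmeasD nab nab) (nnmeasD nba nba)).
by rewrite (sp_addE x spT nab nab) (sp_addE x spT nba nba).
Qed.

Let fin_beta T : excessive T -> pairing m r (T h) \is a fin_num.
Proof.
move=> [spT Th]; have nTh := sp_nnmeas spT nh.
rewrite ge0_fin_numE; last exact: pairing_ge0.
by apply: le_lt_trans hr_lty; rewrite [leRHS]pairingC; apply: le_pairing.
Qed.

Let int_pos T : excessive T -> \int[m]_x pos T x =
  (2 * (fine (pairing m a (T a)) + fine (pairing m b (T b))))%:E.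
Proof.
move=> exT; have [f1 f2 _] := pairing_fin_num exT.
have [spT _] := exT; have nT := sp_nnmeas spT.
have n1 := nnmeasM na (nT _ na); have n2 := nnmeasM nb (nT _ nb).
rewrite !nn_integralD//; [|exact: nnmeasD..].
rewrite -!/(pairing _ _ _) -(fineK f1) -(fineK f2) -!EFinD /=.
by congr EFin; lra.
Qed.

Let int_mix T : excessive T -> \int[m]_x mix T x =
  (2 * mass_form T + 4 * fine (pairing m a (T b)))%:E.
Proof.
move=> exT; have [_ _ f3] := pairing_fin_num exT.
have [spT _] := exT; have nT := sp_nnmeas spT.
have n1 := nnmeasM nh (nT _ nr); have n2 := nnmeasM nr (nT _ nh).
have n3 := nnmeasM na (nT _ nb); have n4 := nnmeasM nb (nT _ na).
rewrite !nn_integralD//; [|exact: nnmeasD..|by do ?apply: nnmeasD].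
rewrite -!/(pairing _ _ _) (pairing_excessiveC exT) -(sp_sym spT)//.
rewrite (pairingC _ _ r) /mass_form -(fineK f3) -(fineK (fin_beta exT)).
by rewrite -!EFinD /=; congr EFin; lra.
Qed.

(** [mixE] is integrated; the integral of [pos] is finite and can be cancelled. *)
Lemma integral_square_form T : excessive T ->
  nnmeas (fun x => T (w x) x) ->
  \int[m]_x T (w x) x = (2 * (mass_form T - signed_form T))%:E.
Proof.
move=> exT nTw.
have : \int[m]_x (T (w x) x + pos T x) = \int[m]_x mix T x.
  by apply: eq_integral => x _; exact: mixE.
rewrite nn_integralD ?int_pos ?int_mix//; last exact: npos.
set C := (X in _ + X%:E); move=> eq; rewrite -[LHS](@addeK _ C%:E)// eq.
by rewrite -EFinB /signed_form /C; congr EFin; lra.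
Qed.

(** Measurability of the diagonal map x |-> S (w x) x is not assumed, so the pointwise inequality is
    first rewritten by [mixE] between sums of [mix] and [pos], which are measurable. *)
Lemma le_square_form S T : excessive S -> excessive T ->
  (forall x, S (w x) x <= T (w x) x) ->
  (mass_form S - signed_form S <= mass_form T - signed_form T)%R.
Proof.
move=> exS exT ST.
have : \int[m]_x (mix S x + pos T x) <= \int[m]_x (mix T x + pos S x).
  apply: nn_le_integral; [apply: nnmeasD; [exact: nmix|exact: npos]..|].
  move=> x; rewrite -!mixE// -addeA -[leRHS]addeA; apply: leeD => //.
  by rewrite addeC.
have [[n1 n2] [n3 n4]] := ((npos exS, npos exT), (nmix exS, nmix exT)).
rewrite (nn_integralD _ n3 n2) (nn_integralD _ n4 n1).
rewrite !int_pos// !int_mix// -!EFinD lee_fin /signed_form; lra.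
Qed.

Hypothesis w_diag : forall x, w x x = 0.

(** The identity operator makes no jumps: its square form only sees w(x, x) = 0. *)
Lemma signed_form_id : signed_form (fun v => v) = fine (pairing m h r).
Proof.
have := integral_square_form excessive_id.
under eq_integral do rewrite w_diag.
rewrite integral0 => /(_ _) eq.
have /eq/eqP : nnmeas (fun x => w x x).
  by rewrite (_ : (fun x => _) = cst 0); [exact: nnmeas_cst|exact/funext].
by rewrite eqe /mass_form pairingC => /eqP; lra.
Qed.

Variable P : (X -> \bar R) -> X -> \bar R.
Variable kappa : X -> \bar R.
Hypothesis exP : excessive P.
Hypothesis nkappa : nnmeas kappa.
Let S v x := P v x + kappa x * v x.
Hypothesis S_le : forall x, S h x <= h x.
Hypothesis S_eq : forall x, r x != 0 -> S h x = h x.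

Let exS : excessive S.
Proof. by split=> //; apply: symmetric_positive_addM => //; case: exP. Qed.

(* Passing from P to S = P + kappa only adds diagonal jumps, which the square
   form does not see, and the iterates of S dominate those of P. *)
Lemma square_form_iter n :
  (mass_form (iter (2 * n) P) - signed_form (iter (2 * n) P)
   <= (2 * n)%:R * (mass_form P - signed_form P))%R.
Proof.
have [[spP _] [spS _]] := (exP, exS).
have PS v : nnmeas v -> forall x, P v x <= S v x.
  by move=> nv x; apply: leeDl; case: (nnmeasM nkappa nv).
have exSn := excessive_iter (2 * n) exS.
apply: (@le_trans _ _ (mass_form (iter (2 * n) S) - signed_form (iter (2 * n) S))%R).
  apply: le_square_form => //; first exact: excessive_iter.
  by move=> x; exact: (le_iter (2 * n) spP spS PS (nw x) x).
apply: (@le_trans _ _ (signed_form (fun v => v) - signed_form (iter (2 * n) S))%R).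
  rewrite lerB// signed_form_id fine_le//; first exact: fin_beta.
    by rewrite ge0_fin_numE//; exact: pairing_ge0.
  rewrite [leRHS]pairingC; have [spSn Snh] := exSn.
  by apply: le_pairing => //; exact: (sp_nnmeas spSn).
apply: (le_trans (signed_form_iter n exS)).
apply: ler_wpM2l => //.
(* S preserves [h] wherever [r] lives, so its mass form is the full <h, r>. *)
have -> : signed_form (fun v => v) = mass_form S.
  rewrite signed_form_id /mass_form pairingC; congr fine.
  apply: eq_integral => x _; have [->|rx] := eqVneq (r x) 0.
    by rewrite !mul0e.
  by rewrite S_eq.
by apply: le_square_form => // x; rewrite /S w_diag mule0 adde0.
Qed.

End comparison.
End signed_form.

(** * Almost everywhere derivability of a monotone absolutely continuous function *)

Section absolutely_continuous_derivable.
Context (R : realType).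
Implicit Types f : R -> R.
Local Notation leb := (@lebesgue_measure R).

Lemma absolutely_continuous_right_continuous f :
  absolutely_continuous_fun f -> right_continuous f.
Proof.
move=> ac x; apply/cvgrPdist_lt => e e0.
have [del del0 acdel] := ac x (x + 1)%R e e0.
near=> y.
have xy : (x < y)%R by near: y; exact: nbhs_right_gt.
have y1 : (y < x + 1)%R by near: y; apply: nbhs_right_lt; rewrite ltrDl.
have yd : (y < x + del)%R by near: y; apply: nbhs_right_lt; rewrite ltrDl.
have := acdel 1%N (fun=> x) (fun=> y).
rewrite !big_ord1 distrC; apply.
- by move=> _; rewrite lexx !ltW.
- by move=> i j _ _ _; rewrite !ord1.
- by rewrite ltrBlDl.
Unshelve. all: by end_near. Qed.

Section stieltjes.
Variable g : cumulative R R.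
Hypothesis ac : absolutely_continuous_fun g.
Local Notation nu := (lebesgue_stieltjes_measure g).

Let stieltjes_ocitv (a b : R) : (a <= b)%R ->
  nu `]a, b]%classic = (g b - g a)%:E.
Proof.
move=> ab; rewrite /lebesgue_stieltjes_measure/= /measure_extension.
rewrite measurable_mu_extE/=; last exact: is_ocitv.
by rewrite wlength_itv_bnd.
Qed.

Let ocitv_measurable (A : set R) : ocitv A ->
  measurable (A : set (measurableTypeR R)).
Proof. by move=> oA; exact: sub_sigma_algebra. Qed.

(** [A] is a finite disjoint union of half-open intervals, whose lengths and increments are exactly
    what absolute continuity compares. *)
Let ring_small (a b e del : R) (A : set R) :
  (forall (n : nat) (l r : 'I_n -> R),
    (forall i, (a <= l i)%R /\ (l i <= r i)%R /\ (r i <= b)%R) ->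
    trivIset [set: 'I_n] (fun i => `]l i, r i[%classic) ->
    (\sum_(i < n) (r i - l i) < del)%R ->
    (\sum_(i < n) `|g (r i) - g (l i)| < e)%R) ->
  A `<=` `]a, b]%classic ->
  (measurable : set (set (SetRing.type (ocitv_type R)))) A ->
  leb A < del%:E -> nu A <= e%:E.
Proof.
move=> acd Aab /SetRing.ring_finite_set[B [/finite_seqP[s0 Bs0] B0 tB mB AB]] lA.
(* Without repetitions, distinct indices name distinct and hence disjoint intervals. *)
pose s := undup s0.
have Bs : B = [set` s] by rewrite Bs0; apply/seteqP; split=> x /=; rewrite mem_undup.
pose n := size s; pose I (i : 'I_n) := nth set0 s i.
have BI i : B (I i) by rewrite Bs /=; exact: mem_nth.
have /choice[lr lrP] : forall i : 'I_n,
    exists x : R * R, (x.1 < x.2)%R /\ I i = `]x.1, x.2]%classic.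
  move=> i; have : ocitv (I i) by apply: mB; rewrite inE; exact: BI.
  move=> /ocitvP[I0|[x x12 ->]]; last by exists x.
  by have [x] := B0 _ (BI i); rewrite I0.
have tI : trivIset [set: 'I_n] I.
  move=> i j _ _ ij; have /eqP := tB _ _ (BI i) (BI j) ij.
  by rewrite nth_uniq ?undup_uniq// => /eqP/ord_inj.
have AI : A = \big[setU/set0]_(i < n) I i.
  by rewrite AB Bs bigcup_seq (big_nth set0) big_mkord.
have mI i : measurable (I i : set (measurableTypeR R)).
  by apply: ocitv_measurable; apply: mB; rewrite inE; exact: BI.
have mUI : measurable (\big[setU/set0]_(i < n) I i : set (measurableTypeR R)).
  exact: bigsetU_measurable.
have Iab i : (a <= (lr i).1)%R /\ ((lr i).2 <= b)%R.
  have [lt IE] := lrP i.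
  have sub x : ((lr i).1 < x)%R -> (x <= (lr i).2)%R -> (a < x)%R && (x <= b)%R.
    move=> lx xr; have : `]a, b]%classic x.
      by apply: Aab; rewrite AB; exists (I i); [exact: BI|rewrite IE /= in_itv/= lx].
    by rewrite /= in_itv.
  split; last by have /andP[] := sub _ lt (lexx _).
  (* If the left end were below [a], the smaller of [a] and the right end would lie in the interval
     but not in ]a, b]. *)
  rewrite leNgt; apply/negP => la.
  have := sub (Num.min a (lr i).2); rewrite lt_min la lt ge_min lexx orbT.
  by move=> /(_ isT isT)/andP[]; rewrite lt_min ltxx.
have nuA : nu A = (\sum_(i < n) (g (lr i).2 - g (lr i).1))%:E.
  rewrite AI measure_semi_additive_ord// -sumEFin; apply: eq_bigr => i _.
  by have [lt ->] := lrP i; apply: stieltjes_ocitv; exact: ltW.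
have lebA : leb A = (\sum_(i < n) ((lr i).2 - (lr i).1))%:E.
  rewrite AI measure_semi_additive_ord// -sumEFin; apply: eq_bigr => i _.
  have [lt ->] := lrP i; have := lebesgue_measure_itv `](lr i).1, (lr i).2]%R.
  by rewrite /= lte_fin lt EFinB.
rewrite nuA lee_fin; apply: ltW; apply: le_lt_trans (acd n _ _ _ _ _).
- by apply: ler_sum => i _; exact: ler_norm.
- by move=> i; have [? ?] := Iab i; split=> //; split=> //; apply: ltW; case: (lrP i).
- move=> i j _ _ [x [xi xj]]; apply: tI => //; exists x.
  by rewrite !(lrP _).2 /=; split; exact: subset_itv_oo_oc.
- by move: lA; rewrite lebA lte_fin.
Qed.

(** A null set is covered by half-open intervals of total length below [del]. Each finite union of
    them, cut down to [D], has Stieltjes mass at most [e], and continuity from below extends this to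
    the whole cover. *)
Let null_part (b : R) (A : set (measurableTypeR R)) : measurable A -> leb A = 0 ->
  nu (A `&` `](-1)%R, b]%classic) = 0.
Proof.
move=> mA A0; set D := `](-1)%R, b]%classic.
have mD : measurable (D : set (measurableTypeR R)).
  by apply: ocitv_measurable; exact: is_ocitv.
apply/eqP; rewrite eq_le measure_ge0 andbT; apply/lee_addgt0Pr => e e0.
rewrite add0e; have [del del0 acd] := ac (-1)%R b e0.
have : leb A < del%:E by rewrite A0 lte_fin.
rewrite /lebesgue_measure/= /lebesgue_stieltjes_measure/= /measure_extension.
move=> /ereal_inf_lt[_ [M [mM AM] <-] Mdel].
pose M' k := M k `&` D.
have mM' k : (measurable : set (set (ocitv_type R))) (M' k).
  by apply: measurableI; [exact: mM|exact: is_ocitv].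
pose B n := \big[setU/set0]_(k < n) M' k.
have BD n : B n `<=` D.
  by rewrite /B -bigcup_mkord => x [k _ []].
have nuB n : nu (B n) <= e%:E.
  apply: (ring_small acd (BD n)).
    apply: bigsetU_measurable => k _; exact: SetRing.measurable_subring.
  (* The cover [M] of [A] also covers [B n], so its total length bounds the outer measure of
     [B n]. *)
  apply: le_lt_trans Mdel.
  apply: ereal_inf_lbound; exists M => //; split=> // x.
  by rewrite /B -bigcup_mkord => -[k _ [Mx _]]; exists k.
have mB n : measurable (B n : set (measurableTypeR R)).
  by apply: bigsetU_measurable => k _; apply: ocitv_measurable; exact: mM'.
have ndB : nondecreasing_seq B.
  by apply/nondecreasing_seqP => n; apply/subsetPset; rewrite /B big_ord_recr/=; exact: subsetUl.
have cvB : (nu \o B) n @[n --> \oo] --> nu (\bigcup_n B n).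
  by apply: nondecreasing_cvg_mu => //; exact: bigcup_measurable.
apply: (@le_trans _ _ (nu (\bigcup_n B n))).
  apply: le_measure; rewrite ?inE; [exact: measurableI|exact: bigcup_measurable|].
  move=> x [Ax Dx]; have [k _ Mkx] := AM _ Ax; exists k.+1 => //.
  by rewrite /B -bigcup_mkord; exists k => //=.
rewrite -(cvg_lim _ cvB)//; apply: lime_le; first by apply/cvg_ex; eexists; exact: cvB.
by apply: nearW.
Qed.

(** On ]-1, b] the Stieltjes measure is finite and dominated by Lebesgue measure, so g(y) - g(-1) is
    the integral of a Radon-Nikodym density and Lebesgue differentiation applies. Only positive
    points matter later; -1 is an arbitrary base point to their left. *)
Lemma absolutely_continuous_ae_derivable_lt (b : R) :
  {ae leb, forall x, (-1 < x)%R -> (x < b)%R -> derivable g x 1}.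
Proof.
set D := `](-1)%R, b]%classic.
have [b1|b1] := leP b (-1)%R.
  by apply: aeW => x x1 /lt_trans /(_ (le_lt_trans b1 x1)); rewrite ltxx.
have mD : measurable (D : set (measurableTypeR R)).
  by apply: ocitv_measurable; exact: is_ocitv.
have nuD : nu D < +oo by rewrite stieltjes_ocitv ?ltry// ltW.
pose nuf : {finite_measure set (measurableTypeR R) -> \bar R} := mfrestr mD nuD.
have dom : nuf `<< leb.
  by apply/null_content_dominatesP => A mA A0; exact: null_part.
have [phi [phi0 phif phii phiE]] := radon_nikodym_sigma_finite dom.
have iphi (A : set R) : measurable A -> leb.-integrable A (EFin \o (fine \o phi)).
  move=> mA; apply: (@integrableS _ _ _ _ setT) => //.
  by apply: eq_integrable phii => // x _; rewrite /= fineK.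
have lphi := open_integrable_locally openT (iphi _ measurableT).
have := @FTC1 R (fine \o phi) (BRight (-1)%R) (fun y => iphi _ (measurable_itv _)) lphi.
apply: filterS; first exact: (ae_filter_ringOfSetsType leb).
move=> x /= dF x1 xb.
have [dFx _] := dF x1.
have := derivableD dFx (derivable_cst (g (-1)%R) x 1%R).
apply: near_eq_derivable; near=> y.
have y1 : (-1 < y)%R by near: y; exact: lt_nbhsr.
have yb : (y < b)%R by near: y; exact: lt_nbhsl.
have IE : \int[leb]_(t in `](-1)%R, y]) ((fine \o phi) t)%:E = (g y - g (-1))%:E.
  transitivity (\int[leb]_(t in `](-1)%R, y]) phi t).
    by apply: eq_integral => t _; rewrite /= fineK.
  rewrite -phiE; last exact: measurable_itv.
  rewrite /= /mfrestr /mrestr setIidl.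
    by apply: stieltjes_ocitv; exact: ltW.
  by apply: subset_itvl; rewrite bnd_simp ltW.
rewrite /Rintegral; change (fine (\int[leb]_(t in `](-1)%R, y]) ((fine \o phi) t)%:E)
  + g (-1) = g y)%R.
by rewrite IE /= subrK.
Unshelve. all: by end_near. Qed.

End stieltjes.

Lemma absolutely_continuous_ae_derivable f :
  {homo f : s t / (s <= t)%R} -> absolutely_continuous_fun f ->
  {ae leb, forall x, (-1 < x)%R -> derivable f x 1}.
Proof.
move=> ndf ac; have rcf := absolutely_continuous_right_continuous ac.
pose g : cumulative R R := HB.pack f (isCumulative.Build R _ R f ndf rcf).
have : {ae leb, forall x, forall n, (-1 < x)%R -> (x < n%:R)%R -> derivable f x 1}.
  apply: ae_foralln => n.
  exact: (@absolutely_continuous_ae_derivable_lt g ac n%:R).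
apply: filterS; first exact: (ae_filter_ringOfSetsType leb).
by move=> x dx x1; apply: (dx (Num.truncn x).+1 x1); exact: truncnS_gt.
Qed.
End absolutely_continuous_derivable.

(** * Lower limits, and convergence of integrals along sequences *)

Section sequence_liminf.
Context (R : realType).
Implicit Types u : (\bar R)^nat.

Lemma lee_of_lt_EFin (a b : \bar R) :
  (forall M : R, M%:E < a -> M%:E <= b) -> a <= b.
Proof.
case: a => [a| |] h; last by rewrite leNye.
  apply/lee_subgt0Pr => e e0; rewrite -EFinB; apply: h.
  by rewrite lte_fin ltrBlDr ltrDl.
by rewrite leye_eq; apply/eqP/eqyP => M _; apply: h; exact: ltry.
Qed.

Lemma limn_einf_sup_einfs u : limn_einf u = ereal_sup (range (einfs u)).
Proof. by rewrite limn_einf_lim; apply/cvg_lim => //; exact: cvg_einfs_sup. Qed.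

Lemma le_limn_einf u a :
  (forall M : R, M%:E < a -> \forall n \near \oo, M%:E <= u n) -> a <= limn_einf u.
Proof.
move=> Mu; apply: lee_of_lt_EFin => M /Mu[N _ uN].
rewrite limn_einf_sup_einfs; apply: (@le_trans _ _ (einfs u N)).
  by apply: le_ereal_inf_tmp => _ [n /= Nn <-]; exact: uN.
by apply: ereal_sup_ubound; exists N.
Qed.

Lemma lt_limn_einf u (M : R) :
  M%:E < limn_einf u -> \forall n \near \oo, M%:E < u n.
Proof.
rewrite limn_einf_sup_einfs => /ereal_sup_gt[_ [N _ <-] MN].
exists N => // n Nn; apply: (lt_le_trans MN).
by apply: ereal_inf_lbound; exists n.
Qed.

Lemma measurable_limn_einf d (X : measurableType d) (u : (X -> \bar R)^nat) :
  (forall n, measurable_fun setT (u n)) ->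
  measurable_fun setT (fun x => limn_einf (u ^~ x)).
Proof.
move=> mu; apply: measurableT_comp => //.
by apply: measurable_fun_limn_esup => n; exact: measurableT_comp.
Qed.

Lemma limn_einf_ge0 u : (forall n, 0 <= u n) -> 0 <= limn_einf u.
Proof.
move=> u0; apply: le_limn_einf => M M0; apply: nearW => n.
by apply: le_trans (u0 n); exact: ltW.
Qed.

End sequence_liminf.

Section integral_without_measurability.
Context d (X : measurableType d) (R : realType).
Variable m : {measure set X -> \bar R}.
Implicit Types F G : X -> \bar R.

(* The integral of a nonnegative function is a supremum over the simple
   functions below it, hence monotone without measurability. *)
Lemma ge0_le_integral_raw F G : (forall x, 0 <= F x) -> (forall x, F x <= G x) ->
  \int[m]_x F x <= \int[m]_x G x.
Proof.
move=> F0 FG; have G0 x : 0 <= G x by exact: le_trans (FG x).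
rewrite !ge0_integralTE//; apply: ereal_sup_le => _ [h hF <-].
by exists h => // x; exact: le_trans (FG x).
Qed.

(** F lies between two measurable modifications of G, equal to 0 and to [+oo] on the exceptional
    null set. The intended F involves [derive1 f], for which no measurability is established. *)
Lemma ae_eq_integral_raw F G : (forall x, 0 <= F x) -> nnmeas G ->
  {ae m, forall x, F x = G x} -> \int[m]_x F x = \int[m]_x G x.
Proof.
move=> F0 [mG G0] [N [mN N0 FG]].
have mNC : measurable (~` N) by exact: measurableC.
have off x : (~` N) x -> F x = G x.
  by move=> Nx; apply: contrapT => FGx; apply: Nx; exact: FG.
have ae_off (H : X -> \bar R) : (forall x, (~` N) x -> H x = G x) -> ae_eq m setT H G.
  by move=> HG; exists N; split=> // x /= HGx; apply: contrapT => /HG.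
have patch_off (c : \bar R) : 0 <= c ->
    let H := (fun x => if x \in N then c else G x) in
    nnmeas H /\ \int[m]_x H x = \int[m]_x G x.
  move=> c0 H; have nH : nnmeas H.
    split=> [|x]; last by rewrite /H; case: ifP.
    apply: measurable_fun_ifT => //; apply: (measurable_fun_bool true).
    rewrite setTI (_ : _ @^-1` _ = N)//.
    apply/seteqP; split => x /=; [exact: set_mem|exact: mem_set].
  split=> //; have [mH H0] := nH.
  apply: ge0_ae_eq_integral => //; apply: ae_off => x Nx.
  by rewrite /H memNset.
apply/eqP; rewrite eq_le; apply/andP; split.
  have [[_ H0] <-] := patch_off +oo (leey _).
  apply: ge0_le_integral_raw => // x; case: ifPn => [_|]; first exact: leey.
  by rewrite notin_setE => /off ->.
have [[_ H0] <-] := patch_off 0 (lexx _).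
apply: ge0_le_integral_raw => // x; case: ifPn => [_ //|].
by rewrite notin_setE => /off ->.
Qed.

(** The dominating function is a multiple of the limit: if the limit is integrable this is dominated
    convergence, and otherwise Fatou's lemma alone sends the integrals to [+oo]. *)
Lemma cvg_integral_le_lim (u : (X -> \bar R)^nat) (a : X -> \bar R) (c : R) :
  (forall n, nnmeas (u n)) -> nnmeas a ->
  {ae m, forall x, u n x @[n --> \oo] --> a x} ->
  {ae m, forall x n, u n x <= c%:E * a x} ->
  \int[m]_x u n x @[n --> \oo] --> \int[m]_x a x.
Proof.
move=> nu na ua uc; have [ma a0] := na.
have mu n : measurable_fun setT (u n) by have [] := nu n.
have u0 n x : 0 <= u n x by have [_] := nu n.
have [aoo|aoo] := eqVneq (\int[m]_x a x) +oo.
  rewrite aoo; apply/cvgeyPge => M.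
  have : M%:E < limn_einf (fun n => \int[m]_x u n x).
    apply: lt_le_trans (fatou m measurableT mu (fun n x _ => u0 n x)).
    rewrite (_ : \int[m]_x _ = +oo) ?ltry// -aoo.
    apply: ge0_ae_eq_integral => //; first exact: measurable_limn_einf.
      by move=> x _; exact: limn_einf_ge0.
    apply: filterS ua => x ux _.
    by have [-> _] := cvg_limn_einf_sup ux.
  by move=> /lt_limn_einf; apply: filterS => n /ltW.
have ia : m.-integrable setT (fun x => c%:E * a x).
  apply: integrableZl => //; apply/integrableP; split=> //.
  under eq_integral do rewrite gee0_abs//.
  by rewrite ltey.
have uc' : {ae m, forall x n, setT x -> `|u n x| <= c%:E * a x}.
  by apply: filterS uc => x ucx n _; rewrite gee0_abs.
have ua' : {ae m, forall x, setT x -> u n x @[n --> \oo] --> a x}.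
  by apply: filterS ua => x ux _.
by have [_ _] := dominated_convergence measurableT mu ma ua' ia uc'.
Qed.

End integral_without_measurability.

Section translation.
Context (R : realType).

(** The image of Lebesgue measure under a translation agrees with it on half-open intervals, hence
    everywhere. *)
Lemma integral_translation (F : measurableTypeR R -> \bar R) (t : R) : nnmeas F ->
  \int[@lebesgue_measure R]_s F (s + t)%R = \int[@lebesgue_measure R]_s F s.
Proof.
move=> [mF F0].
have mt : measurable_fun [set: measurableTypeR R]
    (fun s : measurableTypeR R => (s + t)%R : measurableTypeR R).
  exact: measurable_funD.
rewrite -(@ge0_integral_pushforward _ _ _ _ _ _ mt (@lebesgue_measure R) setT F)//.
apply: eq_measure_integral => A mA _; apply/esym.
apply: lebesgue_measure_unique => //= _ [[a b]] _ <-.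
rewrite /pushforward /=.
have -> : (fun s => (s + t)%R) @^-1` `]a, b] = `](a - t)%R, (b - t)%R]%classic.
  by apply/seteqP; split => x /=; rewrite !in_itv/= ltrBlDr lerBrDr.
rewrite !lebesgue_measure_itv/= !lte_fin ltrD2r.
by case: ifP => // _; rewrite -!EFinB; congr EFin; lra.
Qed.
End translation.

Section vanishing_sequence.
Context (R : realType).
Local Open Scope ring_scope.

(** Fatou's lemma and dominated convergence run along sequences of times; [e] keeps all terms within
    the range of the slope bound. *)
Definition vanishing (e : R) (n : nat) : R := e / n.+1%:R.

Lemma vanishing_gt0 e n : 0 < e -> 0 < vanishing e n.
Proof. by move=> e0; apply: divr_gt0. Qed.

Lemma vanishing_le e n : 0 < e -> vanishing e n <= e.
Proof.
by move=> e0; rewrite /vanishing ler_pdivrMr// ler_peMr ?ler1n// ltW.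
Qed.

Lemma cvg_vanishing e : vanishing e n @[n --> \oo] --> (0 : R).
Proof.
rewrite -(mulr0 e); apply: (@cvgM _ _ _ _ (cst e) (@harmonic R)).
  exact: cvg_cst.
exact: cvg_harmonic.
Qed.

Lemma cvg_vanishing_right e : 0 < e -> vanishing e n @[n --> \oo] --> (0 : R)^'+.
Proof.
move=> e0 A dA; change (\forall n \near \oo, A (vanishing e n)).
have H : \forall n \near \oo, 0 < vanishing e n -> A (vanishing e n).
  exact: (@cvg_vanishing e _ dA).
by apply: filterS H => n; apply; exact: vanishing_gt0.
Qed.

End vanishing_sequence.

(** * The profile f: backward difference quotients and the slope bound *)

Section profile.
Context (R : realType).
Variable f : R -> R.
Hypothesis f_nd : {homo f : s t / (s <= t)%R}.
Local Open Scope ring_scope.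

Definition backward_slope (t s : R) : R := (f s - f (s - t)) / t.

Lemma backward_slope_ge0 t s : 0 < t -> 0 <= backward_slope t s.
Proof.
move=> t0; apply: divr_ge0; last exact: ltW.
by rewrite subr_ge0; apply: f_nd; rewrite gerBl ltW.
Qed.

Lemma cvg_backward_slope (e s : R) : 0 < e -> derivable f s 1 ->
  backward_slope (vanishing e n) s @[n --> \oo] --> derive1 f s.
Proof.
move=> e0 ds; rewrite derive1E.
(* The backward slope is the quotient defining the derivative, taken at a negative step. *)
pose F h := h^-1 *: ((f \o shift s) (h *: (1 : R)) - f s).
pose t n : R := - vanishing e n.
have -> : (fun n => backward_slope (vanishing e n) s) = F \o t.
  apply/funext => n; rewrite /backward_slope /F /t /= scaler1 (addrC _ s).
  by rewrite invrN scaleNr -scalerN opprB mulrC.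
apply: (@cvg_comp _ _ _ _ _ _ (0 : R)^' _ _ ds).
move=> A dA; change (\forall n \near \oo, A (t n)).
have t0 : t n @[n --> \oo] --> (0 : R).
  by rewrite -oppr0; apply: cvgN; exact: cvg_vanishing.
have H : \forall n \near \oo, t n != 0 -> A (t n) by exact: (t0 _ dA).
apply: filterS H => n; apply.
by rewrite oppr_eq0 gt_eqF// vanishing_gt0.
Qed.

Lemma derive1_nonderivable (s : R) : ~ derivable f s 1 -> derive1 f s = 0.
Proof.
move=> nds; rewrite derive1E; apply: getPN => l fl; apply: nds.
by apply/cvg_ex; exists l; exact: fl.
Qed.

Lemma derive1_ge0 (s : R) : 0 <= derive1 f s.
Proof.
have [ds|/derive1_nonderivable->//] := pselect (derivable f s 1).
have := cvg_backward_slope ltr01 ds => /cvg_lim <-//.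
apply: limr_ge; first by apply/cvg_ex; eexists; exact: cvg_backward_slope.
by apply: nearW => n; apply: backward_slope_ge0; exact: vanishing_gt0.
Qed.

(** Valid at every s, since the default value 0 lies below all slopes; the inequality of part (i)
    thus needs no almost everywhere derivability of f. *)
Lemma derive1_le_limn_einf (e s : R) : 0 < e ->
  ((derive1 f s)%:E <=
   limn_einf (fun n => (backward_slope (vanishing e n) s)%:E))%E.
Proof.
move=> e0; have [ds|nds] := pselect (derivable f s 1).
  have : (backward_slope (vanishing e n) s)%:E @[n --> \oo] --> (derive1 f s)%:E.
    by apply: cvg_EFin; [exact: nearW|exact: cvg_backward_slope].
  by move=> /cvg_limn_einf_sup[-> _].
rewrite derive1_nonderivable//; apply: limn_einf_ge0 => n.
by rewrite lee_fin backward_slope_ge0// vanishing_gt0.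
Qed.

(** Halving the threshold admits t = e, the initial term of [vanishing e]; [c] may be raised to a
    nonnegative constant because f' >= 0. *)
Lemma slope_boundP : slope_bound f -> exists e c : R, [/\ 0 < e, 0 <= c &
  forall s t : R, 0 < s -> derivable f s 1 -> 0 < t -> t <= e ->
    backward_slope t s <= c * derive1 f s].
Proof.
move=> [del [c [del0 sb]]]; exists (del / 2), (Num.max c 0).
split=> [||s t s0 ds t0 te]; [by rewrite divr_gt0|by rewrite le_max lexx orbT|].
apply: le_trans (sb s t s0 ds t0 _) _; first by apply: le_lt_trans te _; lra.
by apply: ler_wpM2r; [exact: derive1_ge0|rewrite le_max lexx].
Qed.

End profile.

Section power_profile.
Context (R : realType).
Variables (f : R -> R) (b : R).
Hypothesis b0 : (0 < b)%R.
Hypothesis fE : forall t, f t = (Num.max t 0 `^ b)%R.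
Local Open Scope ring_scope.

(** For b <= 1 this is r <= r^b. For b > 1 it is Bernoulli's inequality, obtained from Young's
    inequality for the product r 1 with exponents b and b / (b - 1). *)
Lemma powR_one_sub (r : R) : 0 <= r -> r <= 1 -> 1 - r `^ b <= Num.max 1 b * (1 - r).
Proof.
rewrite le_eqVlt => /predU1P[<- _|r0 r1].
  by rewrite powR0 ?gt_eqF// !subr0 mulr1 le_max lexx.
have [b1|b1] := leP b 1.
  rewrite mul1r lerB// ger1_powR//; exact/andP.
have b10 : b != 0 by rewrite gt_eqF.
have b11 : b - 1 != 0 by rewrite subr_eq0 gt_eqF.
have q0 : 0 < b / (b - 1) by rewrite divr_gt0// subr_gt0.
have pq : b^-1 + (b / (b - 1))^-1 = 1 by field; rewrite b10 b11.
have := conjugate_powR (ltW r0) ler01 b0 q0 pq.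
rewrite powR1 mulr1.
have -> : 1 / (b / (b - 1)) = 1 - b^-1 by field; rewrite b10 b11.
rewrite -(ler_pM2l b0) mulrDr mulrCA divff// mulr1 mulrBr divff//; lra.
Qed.

Lemma power_profile_derive (s : R) : 0 < s ->
  derivable f s 1 /\ derive1 f s = b * s `^ (b - 1).
Proof.
move=> s0; have [d1 d2] := is_derive1_powR b s0.
have nf : {near s, (fun x => x `^ b) =1 f}.
  near=> x; rewrite fE (max_idPl _)// ltW//; near: x; exact: lt_nbhsr.
split; first exact: near_eq_derivable nf d1.
by rewrite derive1E -(near_eq_derive _ nf)//; exact: oner_neq0.
Unshelve. all: by end_near. Qed.

Lemma power_profile_slope_bound : slope_bound f.
Proof.
(* The estimate holds for all t > 0, so the threshold 1 is arbitrary; dividing by b compensates the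
   factor b in f'. *)
exists 1, (Num.max 1 b / b); split=> // s t s0 _ t0 _.
have [_ ->] := power_profile_derive s0.
have -> : Num.max 1 b / b * (b * s `^ (b - 1)) = Num.max 1 b * s `^ (b - 1).
  by field; rewrite gt_eqF.
(* By homogeneity the slope becomes that of r^b on [0, 1]; the truncation covers t > s. *)
pose r := Num.max (s - t) 0 / s.
have r0 : 0 <= r by apply: divr_ge0; [rewrite le_max lexx orbT|exact: ltW].
have r1 : r <= 1 by rewrite ler_pdivrMr// mul1r ge_max gerBl (ltW t0) (ltW s0).
have sr : Num.max (s - t) 0 = s * r by rewrite mulrC divfK// gt_eqF.
have rt : s * (1 - r) <= t.
  by rewrite mulrBr mulr1 -sr lerBlDr -lerBlDl le_max lexx.
rewrite !fE sr (max_idPl (ltW s0)) (powRM b (ltW s0) r0) ler_pdivrMr//.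
rewrite -{1}(mulr1 (s `^ b)) -mulrBr.
have sb : s `^ b = s * s `^ (b - 1) by rewrite mulr_powRB1// ltW.
apply: (@le_trans _ _ (s `^ b * (Num.max 1 b * (1 - r)))).
  by apply: ler_wpM2l (powR_one_sub r0 r1); exact: powR_ge0.
have -> : s `^ b * (Num.max 1 b * (1 - r)) =
  Num.max 1 b * s `^ (b - 1) * (s * (1 - r)) by rewrite sb; ring.
apply: ler_wpM2l rt; apply: mulr_ge0; last exact: powR_ge0.
by rewrite le_max ler01.
Qed.

End power_profile.

(** The common consequence of the two alternatives of part (ii), and all that the passage to the
    limit uses of them. *)
Definition regular_profile (R : realType) (f : R -> R) : Prop :=
  {ae @lebesgue_measure R, forall s, (0 < s)%R -> derivable f s 1} /\ slope_bound f.

Lemma regular_profileP (R : realType) (f : R -> R) :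
  {homo f : s t / (s <= t)%R} -> f 0%R = 0%R ->
  power_profile f \/ (absolutely_continuous_fun f /\ slope_bound f) ->
  regular_profile f.
Proof.
move=> f_nd f0 [[b b0 fE]|[ac sb]].
  have {}b0 : (0 < b)%R.
    rewrite lt_neqAle b0 andbT; apply/eqP => b00.
    move: f0; rewrite fE -b00 powRr0 => /eqP; rewrite oner_eq0//.
  split; last exact: power_profile_slope_bound b0 fE.
  by apply: aeW => s s0; have [] := power_profile_derive fE s0.
split=> //; have := absolutely_continuous_ae_derivable f_nd ac.
apply: filterS; first exact: (ae_filter_ringOfSetsType (@lebesgue_measure R)).
by move=> s ds s0; apply: ds; apply: lt_trans s0; rewrite ltrN10.
Qed.

(** * The semigroup of p, the functions p_s mu and their time integrals *)

Section tonelli.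
Context (R : realType) d1 d2 (Y : measurableType d1) (Z : measurableType d2).
Variables (m : {sigma_finite_measure set Y -> \bar R}).
Variables (n : {sigma_finite_measure set Z -> \bar R}).

Lemma tonelli_weighted (k : Y -> \bar R) (F : Y * Z -> \bar R) :
  nnmeas k -> nnmeas F ->
  \int[m]_y (k y * \int[n]_z F (y, z)) = \int[n]_z \int[m]_y (k y * F (y, z)).
Proof.
move=> nk nF; have [_ k0] := nk.
have nF1 y : nnmeas (fun z => F (y, z)).
  exact: (nnmeas_comp (pair1_measurable y) nF).
have [mG G0] : nnmeas (fun w : Y * Z => k w.1 * F w).
  by apply: nnmeasM => //; exact: nnmeas_comp nk.
under eq_integral do rewrite -nn_integralZl//.
exact: (fubini_tonelli (fun w : Y * Z => k w.1 * F w)).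
Qed.

End tonelli.

Section density.
Context (R : realType) d (X : measurableType d).
Variables (m mu : {sigma_finite_measure set X -> \bar R}).
Variable p : R -> X -> X -> \bar R.
Hypothesis pd : transition_density m p.
Local Notation leb := (@lebesgue_measure R).

(** Extension by 0 makes the density measurable on the whole product, so time integrals run over the
    line and can be translated. *)
Definition time_ext (s : R) (x y : X) : \bar R := if (0 < s)%R then p s x y else 0.

Lemma nnmeas_time_ext :
  nnmeas (fun z : measurableTypeR R * X * X => time_ext z.1.1 z.1.2 z.2).
Proof.
split=> [|z]; last first.
  by rewrite /time_ext; case: ifPn => // z0; exact: (density_ge0 pd).
pose D := [set z : measurableTypeR R * X * X | (0 < z.1.1)%R].
have mD : measurable D.
  rewrite (_ : D = (fun z => z.1.1) @^-1` `]0%R, +oo[%classic); last first.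
    by apply/seteqP; split=> z; rewrite /D /= in_itv/= andbT.
  rewrite -[X in measurable X]setTI.
  have mf : measurable_fun setT (fun z : measurableTypeR R * X * X => z.1.1).
    by apply: measurableT_comp.
  by apply: mf => //; exact: measurable_itv.
have := density_measurable pd => /(measurable_restrictT _ mD).
apply: eq_measurable_fun => z _; rewrite patchE /time_ext.
by case: ifPn; [rewrite inE /D /= => ->|rewrite notin_setE /D /= => /negP/negbTE->].
Qed.

Lemma nnmeas_density t : (0 < t)%R -> nnmeas (fun z : X * X => p t z.1 z.2).
Proof.
move=> t0.
have mg : measurable_fun setT
    (fun z : X * X => (((t : measurableTypeR R), z.1), z.2)).
  by apply: measurable_fun_pair => //; exact: measurable_fun_pair.
have := nnmeas_comp mg nnmeas_time_ext.
by rewrite /time_ext /= t0.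
Qed.

Lemma nnmeas_density1 t x : (0 < t)%R -> nnmeas (p t x).
Proof. by move=> t0; exact: (nnmeas_comp (pair1_measurable x) (nnmeas_density t0)). Qed.

Definition semigroup (t : R) : (X -> \bar R) -> X -> \bar R := kernel_op m (p t).

Lemma symmetric_positive_semigroup t : (0 < t)%R ->
  symmetric_positive m (semigroup t).
Proof.
move=> t0; apply: symmetric_positive_kernel_op; first exact: nnmeas_density.
by move=> x y; exact: (density_sym pd).
Qed.

Lemma semigroupD s t a : (0 < s)%R -> (0 < t)%R -> nnmeas a ->
  semigroup s (semigroup t a) = semigroup (s + t) a.
Proof.
move=> s0 t0 na; apply/funext => x; rewrite /semigroup /kernel_op.
have na2 : nnmeas (fun z : X * X => p t z.1 z.2 * a z.2).
  by apply: nnmeasM; [exact: nnmeas_density|exact: nnmeas_comp na].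
rewrite (tonelli_weighted m m (nnmeas_density1 x s0) na2).
apply: eq_integral => z _; rewrite -(density_chapman_kolmogorov pd)//.
rewrite muleC -nn_integralZl; last 2 first.
- by case: na.
- apply: nnmeasM; first exact: nnmeas_density1.
  exact: (nnmeas_comp (pair2_measurable z) (nnmeas_density t0)).
by apply: eq_integral => y _; rewrite muleA muleC.
Qed.

Lemma iter_semigroup n t a : (0 < t)%R -> nnmeas a ->
  iter n.+1 (semigroup t) a = semigroup (n.+1%:R * t) a.
Proof.
move=> t0 na; elim: n => [|n IH]; first by rewrite mul1r.
rewrite iterS IH semigroupD ?mulr_gt0//; congr (semigroup _ a).
by rewrite -[in RHS]natr1; ring.
Qed.

Definition measure_density (s : R) (x : X) : \bar R := \int[mu]_y time_ext s x y.

Lemma nnmeas_measure_density :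
  nnmeas (fun z : measurableTypeR R * X => measure_density z.1 z.2).
Proof. exact: (nnmeas_integral mu nnmeas_time_ext). Qed.

Lemma nnmeas_measure_density1 x :
  nnmeas (fun s : measurableTypeR R => measure_density s x).
Proof. exact: (nnmeas_comp (pair2_measurable x) nnmeas_measure_density). Qed.

Lemma semigroup_measure_density s t x : (0 < s)%R -> (0 < t)%R ->
  semigroup t (measure_density s) x = measure_density (s + t) x.
Proof.
move=> s0 t0; rewrite /semigroup /kernel_op /measure_density.
have ns : nnmeas (fun z : X * X => time_ext s z.1 z.2).
  by rewrite /time_ext s0; exact: nnmeas_density.
rewrite (tonelli_weighted m mu (nnmeas_density1 x t0) ns).
apply: eq_integral => z _; rewrite /time_ext s0 addr_gt0// addrC.
exact: (density_chapman_kolmogorov pd).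
Qed.

Section profile_integral.

(** Taking g = f gives h, g = f' gives the integral in the definition of q, and the backward slope
    of step t gives (h - p_t h) / t where h is finite. *)
Definition profile_integral (g : R -> R) (x : X) : \bar R :=
  \int[leb]_s ((g s)%:E * measure_density s x).

Lemma profile_integralE (g : R -> R) x :
  \int[leb]_(s in `]0%R, +oo[) ((g s)%:E * density_measure p mu s x) =
  profile_integral g x.
Proof.
rewrite integral_mkcond; apply: eq_integral => s _; rewrite patchE.
rewrite /measure_density /time_ext; case: ifPn => [|].
  by rewrite inE /= in_itv/= andbT => s0; rewrite s0.
rewrite notin_setE /= in_itv/= andbT => /negP/negbTE ->.
by rewrite integral0 mule0.
Qed.

Lemma nnmeas_profile_integrand (g : R -> R) x :
  nnmeas (fun s : measurableTypeR R => (g s)%:E) ->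
  nnmeas (fun s : measurableTypeR R => (g s)%:E * measure_density s x).
Proof. by move=> ng; apply: nnmeasM => //; exact: nnmeas_measure_density1. Qed.

Lemma nnmeas_profile_integral (g : R -> R) :
  nnmeas (fun s : measurableTypeR R => (g s)%:E) -> nnmeas (profile_integral g).
Proof.
move=> ng; rewrite /profile_integral.
have nG : nnmeas (fun z : X * measurableTypeR R => (g z.2)%:E * measure_density z.2 z.1).
  apply: nnmeasM; first exact: (nnmeas_comp (measurable_snd) ng).
  have ms : measurable_fun setT (fun z : X * measurableTypeR R => (z.2, z.1)).
    exact: measurable_fun_pair.
  exact: (nnmeas_comp ms nnmeas_measure_density).
exact: (nnmeas_integral leb nG).
Qed.

Variable f : R -> R.
Hypothesis f_ge0 : forall s : R, (0 <= f s)%R.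
Hypothesis f_nd : {homo f : s t / (s <= t)%R}.
Hypothesis f_eq0 : forall s : R, (s <= 0)%R -> f s = 0%R.

Let mf : measurable_fun [set: measurableTypeR R] (f : measurableTypeR R -> R).
Proof. exact: nondecreasing_measurable. Qed.

Lemma nnmeas_profile : nnmeas (fun s : measurableTypeR R => (f s)%:E).
Proof. by split=> [|s]; [exact/measurable_EFinP|rewrite lee_fin]. Qed.

Let mft (t : R) : measurable_fun [set: measurableTypeR R]
  ((fun s => f (s - t)%R) : measurableTypeR R -> R).
Proof.
apply: (measurableT_comp mf).
exact: measurable_funB.
Qed.

Lemma nnmeas_backward_slope t : (0 < t)%R ->
  nnmeas (fun s : measurableTypeR R => (backward_slope f t s)%:E).
Proof.
move=> t0; split=> [|s]; last by rewrite lee_fin backward_slope_ge0.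
apply/measurable_EFinP; apply: measurable_funM => //.
exact: measurable_funB.
Qed.

Local Notation h := (profile_integral f).

Lemma nnmeas_h : nnmeas h.
Proof. exact/nnmeas_profile_integral/nnmeas_profile. Qed.

Lemma semigroup_h t x : (0 < t)%R ->
  semigroup t h x = profile_integral (fun s => f (s - t)%R) x.
Proof.
move=> t0; rewrite /semigroup /kernel_op /profile_integral.
have nG : nnmeas (fun z : X * measurableTypeR R => (f z.2)%:E * measure_density z.2 z.1).
  apply: nnmeasM; first exact: (nnmeas_comp (measurable_snd) nnmeas_profile).
  have ms : measurable_fun setT (fun z : X * measurableTypeR R => (z.2, z.1)).
    exact: measurable_fun_pair.
  exact: (nnmeas_comp ms nnmeas_measure_density).
rewrite (tonelli_weighted m leb (nnmeas_density1 x t0) nG).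
have nF : nnmeas (fun s : measurableTypeR R => (f (s - t))%:E * measure_density s x).
  apply: nnmeasM; last exact: nnmeas_measure_density1.
  by split=> [|s]; [exact/measurable_EFinP|rewrite lee_fin].
rewrite -(integral_translation t nF); apply: eq_integral => s _ /=.
(* After the shift p_(s+t) mu need not vanish for -t < s <= 0; there it is f(s) = 0 that removes the
   integrand. *)
rewrite addrK; have [s0|s0] := leP s 0%R.
  rewrite f_eq0// mul0e; under eq_integral do rewrite mul0e mule0.
  by rewrite integral0.
rewrite -semigroup_measure_density// /semigroup /kernel_op.
rewrite -nn_integralZl; last 2 first.
- by rewrite lee_fin.
- apply: nnmeasM; first exact: nnmeas_density1.
  exact: (nnmeas_comp (pair1_measurable s) nnmeas_measure_density).
by apply: eq_integral => y _; rewrite muleCA.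
Qed.

(** Stated as a sum because the difference h - p_t h is meaningless where both are infinite. *)
Lemma h_decomposition t x : (0 < t)%R ->
  h x = semigroup t h x + t%:E * profile_integral (backward_slope f t) x.
Proof.
move=> t0; rewrite semigroup_h// /profile_integral.
have nF : nnmeas (fun s : measurableTypeR R => (f (s - t))%:E * measure_density s x).
  apply: nnmeasM; last exact: nnmeas_measure_density1.
  by split=> [|s]; [exact/measurable_EFinP|rewrite lee_fin].
have nS := nnmeas_profile_integrand x (nnmeas_backward_slope t0).
rewrite -nn_integralZl//; last by rewrite lee_fin ltW.
rewrite -nn_integralD//; last by apply: nnmeasZ => //; rewrite lee_fin ltW.
apply: eq_integral => s _; rewrite muleA -EFinM.
have [_ pm0] := nnmeas_measure_density1 x.
rewrite -ge0_muleDl ?lee_fin//; last first.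
  by apply: mulr_ge0; [exact: ltW|exact: backward_slope_ge0].
congr (_%:E * _); rewrite /backward_slope mulrC divfK ?gt_eqF//.
by rewrite addrC subrK.
Qed.

Lemma excessive_semigroup t : (0 < t)%R -> excessive m h (semigroup t).
Proof.
move=> t0; split; first exact: symmetric_positive_semigroup.
move=> x; rewrite [leRHS](h_decomposition x t0) leeDl//.
apply: mule_ge0; first by rewrite lee_fin ltW.
by have [_] := nnmeas_profile_integral (nnmeas_backward_slope t0).
Qed.

End profile_integral.
End density.

(** * From the signed integral of the approximating form to nonnegative pairings *)

Section signed_kernel_op.
Context (R : realType) d (X : measurableType d).
Variable m : {sigma_finite_measure set X -> \bar R}.
Variable k : X -> X -> \bar R.
Hypothesis nk : nnmeas (fun z : X * X => k z.1 z.2).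
Variables (a b : X -> \bar R) (u : X -> R).
Hypotheses (na : nnmeas a) (nb : nnmeas b) (mu : measurable_fun setT u).
Hypothesis uab : forall x, [/\ (0 <= u x)%R, a x = (u x)%:E & b x = 0] \/
  [/\ (u x < 0)%R, a x = 0 & b x = (- u x)%:E].
Local Notation P := (kernel_op m k).

Let k0 x y : 0 <= k x y.
Proof. by case: nk => _ /(_ (x, y)). Qed.

Lemma kernel_op_signed x : kernel_op m k (EFin \o u) x = P a x - P b x.
Proof.
rewrite /kernel_op integralE; congr (_ - _); apply: eq_integral => y _.
  rewrite funeposE /=; case: (uab y) => -[u0 -> _].
    by rewrite (max_idPl _)// mule_ge0.
  by rewrite mule0 (max_idPr _)// mule_ge0_le0// lee_fin ltW.
rewrite funenegE /= -muleN -EFinN; case: (uab y) => -[u0 _ ->].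
  by rewrite mule0 (max_idPr _)// mule_ge0_le0// lee_fin oppr_le0.
by rewrite (max_idPl _)// mule_ge0// lee_fin oppr_ge0 ltW.
Qed.

Let integrable_nnmeas G : nnmeas G -> \int[m]_x G x \is a fin_num ->
  m.-integrable setT G.
Proof.
move=> [mG G0] fG; apply/integrableP; split=> //.
by under eq_integral do rewrite gee0_abs//; rewrite ltey_eq fG.
Qed.

Variables A B C D : R.
Hypothesis f1 : pairing m a (P a) = A%:E.
Hypothesis f2 : pairing m b (P b) = B%:E.
Hypothesis f3 : pairing m a (P b) = C%:E.
Hypothesis symE : pairing m b (P a) = pairing m a (P b).
Hypothesis sqf : \int[m]_x (u x ^+ 2)%:E = D%:E.

Let nP c : nnmeas c -> nnmeas (P c).
Proof.
move=> nc; have nF := nnmeasM nk (nnmeas_comp measurable_snd nc).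
exact: (nnmeas_integral m nF).
Qed.

Let G1 x := a x * P a x + b x * P b x.
Let G2 x := a x * P b x + b x * P a x.
Let nG1 : nnmeas G1.
Proof. exact: (nnmeasD (nnmeasM na (nP na)) (nnmeasM nb (nP nb))). Qed.
Let nG2 : nnmeas G2.
Proof. exact: (nnmeasD (nnmeasM na (nP nb)) (nnmeasM nb (nP na))). Qed.

(** Where u(x) = 0 both sides vanish, even if P a and P b are infinite; elsewhere the finiteness of
    [G1] and [G2] forces both to be finite. *)
Let pointwise x : G1 x \is a fin_num -> G2 x \is a fin_num ->
  ((u x)%:E - (P a x - P b x)) * (u x)%:E = ((u x ^+ 2)%:E - G1 x) + G2 x.
Proof.
have [_ /(_ x)] := nP na; have [_ /(_ x)] := nP nb; rewrite /G1 /G2.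
move: (P a x) (P b x) => S T.
case: (uab x) => -[u0 -> ->]; rewrite !mul0e ?adde0 ?add0e.
  move: u0; rewrite le_eqVlt => /predU1P[<-|u0].
    by rewrite !mule0 !mul0e expr0n/= sube0 adde0.
  case: S => [S| |//]; case: T => [T| |//] T0 S0; rewrite ?gt0_muley//.
  by move=> _ _; rewrite -!EFinM -!EFinB -!EFinD -?EFinM; congr EFin; ring.
have v0 : 0 < (- u x)%:E by rewrite lte_fin oppr_gt0.
case: S => [S| |//]; case: T => [T| |//] T0 S0; rewrite ?(gt0_muley v0)//.
by move=> _ _; rewrite -!EFinM -!EFinB -!EFinD -?EFinM; congr EFin; ring.
Qed.

Lemma integral_sub_kernel_op :
  \int[m]_x (((u x)%:E - kernel_op m k (EFin \o u) x) * (u x)%:E) =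
  (D - (A + B - 2 * C))%:E.
Proof.
have [[mPa Pa0] [mPb Pb0]] := (nP na, nP nb).
have [[mG1 _] [mG2 _]] := (nG1, nG2).
have nsq : nnmeas (fun x => (u x ^+ 2)%:E).
  split=> [|x]; last by rewrite lee_fin sqr_ge0.
  by apply/measurable_EFinP; exact: measurable_funX.
have iG1E : \int[m]_x G1 x = pairing m a (P a) + pairing m b (P b).
  exact: nn_integralD (nnmeasM na (nP na)) (nnmeasM nb (nP nb)).
have iG2E : \int[m]_x G2 x = pairing m a (P b) + pairing m a (P b).
  rewrite -[X in _ = _ + X]symE.
  exact: nn_integralD (nnmeasM na (nP nb)) (nnmeasM nb (nP na)).
have i1 : m.-integrable setT G1.
  by apply: (integrable_nnmeas nG1); rewrite iG1E f1 f2.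
have i2 : m.-integrable setT G2.
  by apply: (integrable_nnmeas nG2); rewrite iG2E f3.
have i0 : m.-integrable setT (fun x => (u x ^+ 2)%:E).
  by apply: (integrable_nnmeas nsq); rewrite sqf.
have mu' : measurable_fun setT (fun x => (u x)%:E) by exact/measurable_EFinP.
transitivity (\int[m]_x (((u x ^+ 2)%:E - G1 x) + G2 x)).
  apply: ae_eq_integral => //.
  - apply: emeasurable_funM => //; apply: emeasurable_funB => //.
    rewrite (_ : kernel_op m k _ = (fun x => P a x - P b x)).
      exact: emeasurable_funB.
    by apply/funext => x; exact: kernel_op_signed.
  - by apply: emeasurable_funD => //; apply: emeasurable_funB => //; case: nsq.
  (* Integrability makes [G1] and [G2] finite almost everywhere, which is what [pointwise] asks
     for. *)
  have := integrable_ae measurableT i1; have := integrable_ae measurableT i2.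
  apply: filterS2 => x /(_ Logic.I) G2f /(_ Logic.I) G1f _.
  by rewrite kernel_op_signed pointwise.
rewrite integralD//; last exact: integrableB.
rewrite integralB// iG1E iG2E f1 f2 f3 sqf.
by rewrite -?EFinD -?EFinB -?EFinD; congr EFin; ring.
Qed.

End signed_kernel_op.

(** * The ground state identity *)

Section ground_state.
Context (R : realType).
Implicit Types (H K : \bar R) (up un vp vn : R).

(** The expansion (u/H - v/K)^2 H K = H v^2/K + K u^2/H - 2uv, with the cross term split by sign
    between the two sides. Since [fine] sends [+oo] to 0, the hypotheses make u vanish at infinite H
    and v at infinite K, which removes the undefined terms. *)
Lemma ground_state_identity H K up un vp vn : 0 <= H -> 0 <= K ->
  (fine H = 0%R -> up = 0%R /\ un = 0%R) -> (fine K = 0%R -> vp = 0%R /\ vn = 0%R) ->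
  (((up - un) / fine H - (vp - vn) / fine K) ^+ 2)%:E * K * H +
  (up%:E * vp%:E + up%:E * vp%:E + (un%:E * vn%:E + un%:E * vn%:E)) =
  H * ((vp - vn) ^+ 2 / fine K)%:E + ((up - un) ^+ 2 / fine H)%:E * K +
  (up%:E * vn%:E + up%:E * vn%:E + (un%:E * vp%:E + un%:E * vp%:E)).
Proof.
have vanish (a b : R) : a = 0%R -> b = 0%R -> ((a - b) ^+ 2 = 0)%R.
  by move=> -> ->; rewrite subr0 expr0n.
case: H => [h| |//] h0; case: K => [k| |//] k0 Hu Kv.
- rewrite -!EFinM -!EFinD; congr EFin => /=.
  have [h00|hn0] := eqVneq h 0%R.
    by have [-> ->] := Hu h00; rewrite h00; ring.
  have [k00|kn0] := eqVneq k 0%R.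
    by have [-> ->] := Kv k00; rewrite k00; ring.
  by field; rewrite hn0.
- have [-> ->] := Kv erefl; rewrite /= invr0 !mulr0 !subr0 !mule0 !adde0 add0e.
  rewrite -muleA (muleC +oo) muleA -EFinM; congr (_%:E * _).
  have [h00|hn0] := eqVneq h 0%R.
    by have [-> ->] := Hu h00; rewrite h00; ring.
  by field.
- have [-> ->] := Hu erefl; rewrite /= invr0 !mulr0 sub0r sqrrN !mul0e !adde0.
  rewrite -EFinM muleC; congr (_ * _%:E).
  have [k00|kn0] := eqVneq k 0%R.
    by have [-> ->] := Kv k00; rewrite k00; ring.
  by field.
- have [-> ->] := Hu erefl; have [-> ->] := Kv erefl.
  by rewrite /= invr0 !mulr0 subrr expr0n/= !mul0e !mule0 !adde0.
Qed.

Lemma ground_state_domination H K (a b : R) : 0 <= H -> 0 <= K ->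
  (fine H = 0%R -> a = 0%R) -> (fine K = 0%R -> b = 0%R) ->
  a%:E * b%:E + a%:E * b%:E <=
  H * (b ^+ 2 / fine K)%:E + (a ^+ 2 / fine H)%:E * K.
Proof.
move=> H0 K0 Ha Kb.
have := @ground_state_identity H K a 0 b 0 H0 K0
  (fun h => conj (Ha h) erefl) (fun h => conj (Kb h) erefl).
rewrite !subr0 !mul0e !mule0 !adde0 => <-.
rewrite leeDr// !mule_ge0// lee_fin; exact: sqr_ge0.
Qed.

End ground_state.

(** * The three forms expressed through N, phi and beta *)

Section forms.
Context (R : realType) d (X : measurableType d).
Variables (m mu : {sigma_finite_measure set X -> \bar R}).
Variable p : R -> X -> X -> \bar R.
Hypothesis pd : transition_density m p.
Variable f : R -> R.
Hypothesis f_ge0 : forall s : R, (0 <= f s)%R.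
Hypothesis f_nd : {homo f : s t / (s <= t)%R}.
Hypothesis f_eq0 : forall s : R, (s <= 0)%R -> f s = 0%R.
Local Notation h := (profile_integral mu p f).
Variable u : X -> R.
Hypothesis uL2 : u \in Lfun m 2%:E.
Hypothesis u_eq0 : forall x, h x = 0 \/ h x = +oo -> u x = 0%R.

(* Since fine +oo = 0 and x / 0 = 0, the quotients by fine (h x) below vanish
   where h x is 0 or +oo, in accordance with the convention for u / h. *)
Let up x : R := Num.max (u x) 0%R.
Let un x : R := Num.max (- u x)%R 0%R.
Let a x := (up x)%:E.
Let b x := (un x)%:E.
Let r x := (u x ^+ 2 / fine (h x))%:E.
Let w x y := (((u x / fine (h x)) - (u y / fine (h y))) ^+ 2)%:E * h y * h x.

Let mu_ : measurable_fun setT u.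
Proof. by move: uL2; rewrite inE => /andP[]; rewrite inE. Qed.

Let nh : nnmeas h. Proof. exact: (nnmeas_h mu pd f_ge0 f_nd). Qed.
Let h0 x : 0 <= h x. Proof. by case: nh. Qed.

Let na : nnmeas a.
Proof.
split=> [|x]; last by rewrite lee_fin le_max lexx orbT.
by apply/measurable_EFinP; exact: measurable_maxr.
Qed.

Let nb : nnmeas b.
Proof.
split=> [|x]; last by rewrite lee_fin le_max lexx orbT.
by apply/measurable_EFinP; apply: measurable_maxr => //; exact: measurableT_comp.
Qed.

Let mhV : measurable_fun setT (fun x => (fine (h x))^-1)%R.
Proof.
have [mh _] := nh.
have mfh : measurable_fun setT (fun x => fine (h x)) by exact: measurableT_comp.
have := measurableT_comp (measurable_powR (-1)%R) mfh.
by apply: eq_measurable_fun => x _ /=; rewrite powR_inv1// fine_ge0.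
Qed.

Lemma nnmeas_weight : nnmeas (fun x => (u x ^+ 2 / fine (h x))%:E).
Proof.
split=> [|x]; last by rewrite lee_fin divr_ge0 ?fine_ge0 ?sqr_ge0.
by apply/measurable_EFinP; apply: measurable_funM => //; exact: measurable_funX.
Qed.

Let nr : nnmeas r. Proof. exact: nnmeas_weight. Qed.

Let nw2 : nnmeas (fun z : X * X => w z.1 z.2).
Proof.
have n1 : nnmeas (fun z : X * X => h z.1) by exact: (nnmeas_comp measurable_fst nh).
have n2 : nnmeas (fun z : X * X => h z.2) by exact: (nnmeas_comp measurable_snd nh).
rewrite /w; apply: nnmeasM n1; apply: nnmeasM n2.
split=> [|z]; last by rewrite lee_fin sqr_ge0.
apply/measurable_EFinP; apply: measurable_funX.
have mv : measurable_fun setT (fun x => u x / fine (h x))%R by exact: measurable_funM.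
by apply: measurable_funB;
  [apply: measurableT_comp mv measurable_fst|apply: measurableT_comp mv measurable_snd].
Qed.

Let nw x : nnmeas (w x).
Proof. exact: (nnmeas_comp (pair1_measurable x) nw2). Qed.

Let uE x : u x = (up x - un x)%R.
Proof.
rewrite /up /un; have [u0|u0] := leP 0%R (u x).
  by rewrite (max_idPr _) ?subr0// lerNl oppr0.
by rewrite (max_idPl _) ?sub0r ?opprK// lerNr oppr0 ltW.
Qed.

(** [fine (h x)] vanishes exactly where h is 0 or [+oo], which is where u is assumed to vanish. *)
Let u0E x : fine (h x) = 0%R -> u x = 0%R.
Proof.
move=> hx0; apply: u_eq0; have := h0 x; move: hx0.
by case: (h x) => [z /= -> _| |//]; [left|right].
Qed.

Let upn0 x : fine (h x) = 0%R -> up x = 0%R /\ un x = 0%R.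
Proof. by move=> /u0E; rewrite /up /un => ->; rewrite oppr0 maxxx. Qed.

Let wE x y :
  w x y + (a x * a y + a x * a y + (b x * b y + b x * b y)) =
  h x * r y + r x * h y + (a x * b y + a x * b y + (b x * a y + b x * a y)).
Proof.
rewrite /w /r (uE x) (uE y).
by apply: ground_state_identity; [exact: h0|exact: h0|exact: upn0|exact: upn0].
Qed.

Let w_diag x : w x x = 0.
Proof. by rewrite /w subrr expr0n/= !mul0e. Qed.

Let absE x : ((up x + un x) ^+ 2 = u x ^+ 2)%R.
Proof.
rewrite /up /un; have [u0|u0] := leP 0%R (u x).
  by rewrite (max_idPr _) ?addr0// lerNl oppr0.
by rewrite (max_idPl _) ?add0r ?sqrrN// lerNr oppr0 ltW.
Qed.

Let dom x y :
  (a x + b x) * (a y + b y) + (a x + b x) * (a y + b y) <= h x * r y + r x * h y.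
Proof.
rewrite /a /b -!EFinD /r -!absE; apply: ground_state_domination => //.
  by move=> /upn0[-> ->]; rewrite addr0.
by move=> /upn0[-> ->]; rewrite addr0.
Qed.

Let hrE x : h x * r x = (u x ^+ 2)%:E.
Proof.
rewrite /r; have := @u0E x; case: (h x) (h0 x) => [z| |//] z0 hu.
  have [z00|zn0] := eqVneq z 0%R; last by rewrite -EFinM mulrC divfK.
  by rewrite hu// expr0n/= mul0r mule0.
by rewrite hu// expr0n/= mul0r mule0.
Qed.

Let hrN : pairing m h r = \int[m]_x (u x ^+ 2)%:E.
Proof. by apply: eq_integral => x _; exact: hrE. Qed.

Let hr_lty : pairing m h r < +oo.
Proof.
rewrite hrN; have /integrableP[_] := Lfun2_integrable_sqr uL2.
apply: le_lt_trans; rewrite le_eqVlt; apply/orP; left; apply/eqP.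
by apply: eq_integral => x _ /=; rewrite ger0_norm// sqr_ge0.
Qed.

Definition sqr_norm : R := fine (pairing m h r).
Definition form_part t : R := signed_form m a b (semigroup m p t).
Definition mass_part t : R := mass_form m h r (semigroup m p t).
Local Notation N := sqr_norm.
Local Notation phi := form_part.
Local Notation beta := mass_part.

Let exP t : (0 < t)%R -> excessive m h (semigroup m p t).
Proof. by move=> t0; exact: (excessive_semigroup mu pd f_ge0 f_nd f_eq0 t0). Qed.

Let hrf : pairing m h r \is a fin_num.
Proof. by rewrite ge0_fin_numE//; exact: pairing_ge0. Qed.

Let signed_form_iter_semigroup n t : (0 < t)%R ->
  signed_form m a b (iter n.+1 (semigroup m p t)) = phi (n.+1%:R * t)%R.
Proof.
by move=> t0; rewrite /phi /signed_form !(iter_semigroup pd n t0).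
Qed.

Let mass_form_iter_semigroup n t : (0 < t)%R ->
  mass_form m h r (iter n.+1 (semigroup m p t)) = beta (n.+1%:R * t)%R.
Proof.
by move=> t0; rewrite /beta /mass_form !(iter_semigroup pd n t0).
Qed.

Lemma form_part_bound t : (0 < t)%R -> (`|phi t| <= N)%R.
Proof. by move=> t0; apply: signed_form_bound => //; exact: exP. Qed.

Lemma form_part_convex s t : (0 < s)%R -> (0 < t)%R ->
  (2 * phi (s + t) <= phi (2 * s) + phi (2 * t))%R.
Proof.
move=> s0 t0.
apply: (signed_form_convex na nb nh nr dom hr_lty (exP s0) (exP t0)).
- by apply: exP; rewrite mulr_gt0.
- by apply: exP; rewrite mulr_gt0.
- by apply: exP; rewrite addr_gt0.
- by move=> v nv; rewrite (semigroupD pd)// mulr_natl mulr2n.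
- by move=> v nv; rewrite (semigroupD pd)// mulr_natl mulr2n.
- by move=> v nv; rewrite (semigroupD pd).
- by move=> v nv; rewrite (semigroupD pd)// addrC.
Qed.

Lemma form_part_rate n t : (0 < n)%N -> (0 < t)%R ->
  (N - phi ((2 * n)%:R * t) <= (2 * n)%:R * (N - phi t))%R.
Proof.
case: n => // n _ t0.
have := signed_form_iter na nb nh nr dom hr_lty n.+1 (exP t0).
rewrite (signed_form_id na nb nh nr dom hr_lty nw wE w_diag).
rewrite (_ : (2 * n.+1)%N = (2 * n).+2); last by lia.
by rewrite (signed_form_iter_semigroup (2 * n).+1 t0).
Qed.

(** By [h_decomposition] this is (h - p_t h) / h where 0 < h < +oo, and it is 0 elsewhere. *)
Let kappa t x := ((fine (h x))^-1 * t)%:E * profile_integral mu p (backward_slope f t) x.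

Let nslope t : (0 < t)%R -> nnmeas (profile_integral mu p (backward_slope f t)).
Proof.
move=> t0; apply: (nnmeas_profile_integral mu pd).
exact: nnmeas_backward_slope.
Qed.

Let nkappa t : (0 < t)%R -> nnmeas (kappa t).
Proof.
move=> t0; apply: nnmeasM; last exact: nslope.
split=> [|x]; last by rewrite lee_fin mulr_ge0 ?invr_ge0 ?fine_ge0// ltW.
by apply/measurable_EFinP; exact: measurable_funM.
Qed.

Let S_fix t x : (0 < t)%R -> fine (h x) != 0%R ->
  semigroup m p t h x + kappa t x * h x = h x.
Proof.
move=> t0 hx0.
have hxf : h x \is a fin_num by move: hx0; case: (h x) => //=; rewrite eqxx.
rewrite [RHS](h_decomposition mu pd f_ge0 f_nd f_eq0 x t0); congr (_ + _).
rewrite /kappa muleAC -{2}(fineK hxf) -EFinM; congr (_%:E * _).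
by rewrite mulrAC mulVf// mul1r.
Qed.

Let S_le t x : (0 < t)%R -> semigroup m p t h x + kappa t x * h x <= h x.
Proof.
move=> t0; have [hx0|hx0] := eqVneq (fine (h x)) 0%R; last by rewrite S_fix.
rewrite /kappa hx0 invr0 mul0r !mul0e adde0.
by have [_] := exP t0.
Qed.

Lemma square_part_rate n t : (0 < n)%N -> (0 < t)%R ->
  (beta ((2 * n)%:R * t) - phi ((2 * n)%:R * t) <= (2 * n)%:R * (beta t - phi t))%R.
Proof.
case: n => // n _ t0.
have S_eq x : r x != 0 -> semigroup m p t h x + kappa t x * h x = h x.
  move=> rx; apply: S_fix => //; apply: contra rx => /eqP hx0.
  by rewrite /r hx0 invr0 mulr0.
have := square_form_iter na nb nh nr dom hr_lty nw wE w_diag (exP t0)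
  (nkappa t0) (fun x => S_le x t0) S_eq n.+1.
rewrite (_ : (2 * n.+1)%N = (2 * n).+2); last by lia.
by rewrite (signed_form_iter_semigroup (2 * n).+1 t0) (mass_form_iter_semigroup (2 * n).+1 t0).
Qed.

Let nwT t : (0 < t)%R -> nnmeas (fun x => semigroup m p t (w x) x).
Proof.
move=> t0; rewrite /semigroup /kernel_op.
have nF := nnmeasM (nnmeas_density pd t0) nw2.
exact: (nnmeas_integral m nF).
Qed.

(** The 2 in the normalization 1 / (2t) cancels the one in [integral_square_form]. *)
Lemma remainder_formE t : (0 < t)%R ->
  remainder_form m p h u t = ((beta t - phi t) / t)%:E.
Proof.
move=> t0.
have := integral_square_form na nb nh nr dom hr_lty nw wE (exP t0) (nwT t0).
have i2t : 0 <= ((2 * t)^-1)%:E :> \bar R.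
  by rewrite lee_fin invr_ge0 mulr_ge0// ltW.
have ratio : h_ratio u h = fun z => (u z / fine (h z))%R.
  apply/funext => z; rewrite /h_ratio.
  by case: ifP => // /orP[] /eqP ->; rewrite /= invr0 mulr0.
have -> : remainder_form m p h u t =
    ((2 * t)^-1)%:E * \int[m]_x semigroup m p t (w x) x.
  rewrite -nn_integralZl//; last exact: nwT.
  apply: eq_integral => x _; rewrite /semigroup /kernel_op.
  rewrite -(nn_integralZl m i2t (nnmeasM (nnmeas_density1 pd x t0) (nw x))).
  by apply: eq_integral => y _; rewrite ratio /w -!muleA; exact: muleCA.
move=> ->; rewrite -EFinM; congr EFin.
by rewrite /beta /phi; field; rewrite gt_eqF.
Qed.

Lemma square_part_ge0 t : (0 < t)%R -> (0 <= beta t - phi t)%R.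
Proof.
move=> t0.
have := integral_square_form na nb nh nr dom hr_lty nw wE (exP t0) (nwT t0).
have : 0 <= \int[m]_x semigroup m p t (w x) x.
  by apply: integral_ge0 => x _; case: (nwT t0).
move=> /[swap] ->; rewrite lee_fin /beta /phi; lra.
Qed.

Definition potential_part (g : R -> R) : \bar R :=
  \int[m]_x (r x * profile_integral mu p g x).

Lemma potential_partE t : (0 < t)%R ->
  potential_part (backward_slope f t) = ((N - beta t) / t)%:E.
Proof.
move=> t0; have nP := sp_nnmeas (proj1 (exP t0)) nh; have nS := nslope t0.
have t0' : 0 <= t%:E :> \bar R by rewrite lee_fin ltW.
have : pairing m r h = pairing m r (semigroup m p t h) +
    t%:E * potential_part (backward_slope f t).
  rewrite -nn_integralZl//; last exact: nnmeasM.
  rewrite -nn_integralD//; last 2 first.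
  - exact: nnmeasM.
  - by apply: nnmeasZ => //; exact: nnmeasM.
  apply: eq_integral => x _; have [_ r0] := nr; have [_ P0] := nP; have [_ S0] := nS.
  rewrite [in LHS](h_decomposition mu pd f_ge0 f_nd f_eq0 x t0) ge0_muleDr//.
    by rewrite muleCA.
  exact: mule_ge0.
have bf : pairing m r (semigroup m p t h) \is a fin_num.
  rewrite ge0_fin_numE; last exact: pairing_ge0.
  apply: le_lt_trans hr_lty; rewrite [leRHS]pairingC; apply: le_pairing => //.
  by have [_] := exP t0.
rewrite pairingC -(fineK hrf) -(fineK bf) -/N -/(mass_form _ _ _ _) -/(beta t).
(* The potential part is finite because N is: an infinite value would contradict the equation. *)
case: (potential_part _) => [z| |].
- rewrite -EFinM -EFinD => -[->]; congr EFin; field; exact: lt0r_neq0.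
- by rewrite gt0_muley ?lte_fin// addey.
- by rewrite gt0_muleNy ?lte_fin// addeNy.
Qed.

Lemma mass_part_le t : (0 < t)%R -> (beta t <= N)%R.
Proof.
move=> t0; have : 0 <= potential_part (backward_slope f t).
  apply: integral_ge0 => x _; apply: mule_ge0; first by case: nr.
  by have [_] := nslope t0.
by rewrite potential_partE// lee_fin pmulr_lge0 ?invr_gt0// subr_ge0.
Qed.

(** p_t h = p_s (p_(t-s) h) <= p_s h. *)
Lemma mass_part_nonincreasing s t : (0 < s)%R -> (s <= t)%R -> (beta t <= beta s)%R.
Proof.
move=> s0; rewrite le_eqVlt => /predU1P[->//|st].
have ts0 : (0 < t - s)%R by rewrite subr_gt0.
have nP v : (0 < v)%R -> nnmeas (semigroup m p v h).
  by move=> v0; apply: (sp_nnmeas (proj1 (exP v0))).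
have le_fin v : (0 < v)%R -> pairing m r (semigroup m p v h) \is a fin_num.
  move=> v0; rewrite ge0_fin_numE; last exact: pairing_ge0 (nP _ _).
  apply: le_lt_trans hr_lty; rewrite [leRHS]pairingC.
  by apply: le_pairing => //; [exact: nP|have [_] := exP v0].
have t0 : (0 < t)%R by exact: lt_trans st.
apply: fine_le; [exact: le_fin|exact: le_fin|].
apply: (le_pairing m nr nr (nP _ t0) (nP _ s0)) => // x.
rewrite -{1}(subrK s t) addrC -(semigroupD pd s0 ts0 nh).
apply: (sp_le (proj1 (exP s0))) => //; first exact: nP.
by have [_] := exP ts0.
Qed.

Lemma approx_formE t : (0 < t)%R -> approx_form m p u t = ((N - phi t) / t)%:E.
Proof.
move=> t0; have [f1 f2 f3] := pairing_fin_num na nb nh nr dom hr_lty (exP t0).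
have symE := pairing_excessiveC na nb (exP t0).
have nk := nnmeas_density pd t0.
have uab x : [/\ (0 <= u x)%R, a x = (u x)%:E & b x = 0] \/
             [/\ (u x < 0)%R, a x = 0 & b x = (- u x)%:E].
  have [u0|u0] := leP 0%R (u x); [left|right]; (split; first by []);
    rewrite /a /b /up /un; congr EFin.
  - exact: max_idPl.
  - by apply/max_idPr; rewrite lerNl oppr0.
  - by apply/max_idPr; exact: ltW.
  - by apply/max_idPl; rewrite lerNr oppr0 ltW.
have sqf : \int[m]_x (u x ^+ 2)%:E \is a fin_num by rewrite -hrN; exact: hrf.
have := integral_sub_kernel_op nk na nb mu_ uab (esym (fineK f1)) (esym (fineK f2))
  (esym (fineK f3)) symE (esym (fineK sqf)).
rewrite /approx_form => ->; rewrite -EFinM -hrN; congr EFin.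
exact: mulrC.
Qed.

End forms.

(** * Limits multiplied by a possibly infinite factor *)

Section scaling_of_limits.
Context (R : realType).

Lemma limn_einf_scale (u : (\bar R)^nat) (k a : \bar R) :
  0 <= k -> (forall n, 0 <= u n) -> a <= limn_einf u ->
  k * a <= limn_einf (fun n => k * u n).
Proof.
move=> k0 u0 au; have ku0 n : 0 <= k * u n by exact: mule_ge0.
have [a0|a0] := leP a 0.
  by apply: le_trans (limn_einf_ge0 ku0); exact: mule_ge0_le0.
apply: le_limn_einf => M Mka.
case: k k0 ku0 Mka => [k| |//] k0 ku0 Mka; last first.
  have : 0%:E < limn_einf u by exact: lt_le_trans au.
  move=> /lt_limn_einf; apply: filterS => n un0.
  by rewrite gt0_mulye// leey.
move: k0; rewrite lee_fin le_eqVlt => /predU1P[k0|k0].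
  move: Mka; rewrite -k0 mul0e => Mka; apply: nearW => n.
  by rewrite mul0e ltW.
have : (M / k)%:E < limn_einf u.
  apply: lt_le_trans au; case: a a0 Mka => [a| |//] _; rewrite ?ltry//.
  by rewrite -EFinM !lte_fin ltr_pdivrMr// mulrC.
move=> /lt_limn_einf; apply: filterS => n Mun.
by rewrite muleC -lee_pdivrMr// muleC -EFinM mulrC ltW.
Qed.

(** The delicate case is k = +oo with a = 0: domination by a multiple of the limit forces every v(n)
    to be 0, so the products are 0 instead of [+oo]. *)
Lemma cvg_scale_dominated (v : R^nat) (a c : R) (k : \bar R) :
  0 <= k -> (forall n, 0 <= v n)%R -> (forall n, v n <= c * a)%R ->
  v n @[n --> \oo] --> a -> (v n)%:E * k @[n --> \oo] --> a%:E * k.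
Proof.
move=> k0 v0 va cv; have cvE : (v n)%:E @[n --> \oo] --> a%:E.
  by apply: cvg_EFin => //; exact: nearW.
have a0 : (0 <= a)%R.
  rewrite -(cvg_lim _ cv)//; apply: limr_ge; first by apply/cvg_ex; exists a.
  exact: nearW.
case: k k0 => [k| |//] k0.
  rewrite muleC (_ : (fun n => _) = (fun n => k%:E * (v n)%:E)).
    exact: cvgeZl.
  by apply/funext => n; rewrite muleC.
move: a0; rewrite le_eqVlt => /predU1P[a0|a0].
  rewrite -a0 mul0e (_ : (fun n => _) = cst 0); first exact: cvg_cst.
  apply/funext => n; have -> : v n = 0%R.
    by apply/eqP; rewrite eq_le v0 andbT (le_trans (va n))// -a0 mulr0.
  exact: mul0e.
rewrite gt0_muley ?lte_fin//; apply/cvgeyPge => M.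
have : \forall n \near \oo, (0 < v n)%R by exact: (cvgr_gt _ cv).
by apply: filterS => n vn; rewrite gt0_muley ?leey.
Qed.

End scaling_of_limits.

(** * Limits of the potential part *)

Section potential_limit.
Context (R : realType) d (X : measurableType d).
Variables (m mu : {sigma_finite_measure set X -> \bar R}).
Variable p : R -> X -> X -> \bar R.
Hypothesis pd : transition_density m p.
Variable f : R -> R.
Hypothesis f_ge0 : forall s : R, (0 <= f s)%R.
Hypothesis f_nd : {homo f : s t / (s <= t)%R}.
Local Notation leb := (@lebesgue_measure R).
Local Notation Q := (profile_integral mu p (derive1 f)).
Local Notation H e n := (profile_integral mu p (backward_slope f (vanishing e n))).

Let pm0 s x : 0 <= measure_density mu p s x.
Proof. by have [_ /(_ (s, x))] := nnmeas_measure_density mu pd. Qed.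

Let nslope e n x : (0 < e)%R -> nnmeas (fun s : measurableTypeR R =>
  (backward_slope f (vanishing e n) s)%:E * measure_density mu p s x).
Proof.
move=> e0; apply: (nnmeas_profile_integrand mu pd).
by apply: nnmeas_backward_slope => //; exact: vanishing_gt0.
Qed.

Lemma derive_integral_le_limn_einf e x : (0 < e)%R ->
  Q x <= limn_einf (fun n => H e n x).
Proof.
move=> e0; have mF n : measurable_fun setT (fun s : measurableTypeR R =>
    (backward_slope f (vanishing e n) s)%:E * measure_density mu p s x).
  by have [] := nslope n x e0.
have F0 n (s : R) : 0 <= (backward_slope f (vanishing e n) s)%:E * measure_density mu p s x.
  by have [_] := nslope n x e0.
apply: le_trans (fatou leb measurableT mF (fun n s _ => F0 n s)).
apply: ge0_le_integral_raw => s.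
  by apply: mule_ge0; [rewrite lee_fin derive1_ge0|exact: pm0].
rewrite muleC; under eq_fun do rewrite muleC.
apply: limn_einf_scale; [exact: pm0| |exact: derive1_le_limn_einf].
by move=> n; rewrite lee_fin backward_slope_ge0// vanishing_gt0.
Qed.

Lemma cvg_derive_integral (e c : R) x : regular_profile f -> (0 < e)%R ->
  (forall s t : R, (0 < s)%R -> derivable f s 1 -> (0 < t)%R -> (t <= e)%R ->
    (backward_slope f t s <= c * derive1 f s)%R) -> (0 <= c)%R ->
  (H e n x @[n --> \oo] --> Q x) /\ forall n, H e n x <= c%:E * Q x.
Proof.
move=> [dae _] e0 sb c0.
pose sl n (s : R) := (backward_slope f (vanishing e n) s)%:E.
(* The lower limit of the slopes is a measurable substitute for [derive1 f], equal to it at each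
   point of derivability; for s <= 0 the density factor is 0. *)
pose G (s : measurableTypeR R) := limn_einf (sl ^~ s) * measure_density mu p s x.
have nsl n : nnmeas (sl n : measurableTypeR R -> \bar R).
  by apply: nnmeas_backward_slope => //; exact: vanishing_gt0.
have nG : nnmeas G.
  apply: nnmeasM; last exact: (nnmeas_measure_density1 mu pd x).
  split=> [|s]; first exact: (measurable_limn_einf (fun n => proj1 (nsl n))).
  by apply: limn_einf_ge0 => n; exact: (proj2 (nsl n) s).
have slE s : derivable f s 1 -> limn_einf (sl ^~ s) = (derive1 f s)%:E.
  move=> ds; have : sl n s @[n --> \oo] --> (derive1 f s)%:E.
    by apply: cvg_EFin; [exact: nearW|exact: cvg_backward_slope].
  by move=> /cvg_limn_einf_sup[-> _].
have pm_neg s : (s <= 0)%R -> measure_density mu p s x = 0.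
  move=> s0; rewrite /measure_density /time_ext ltNge s0 /=.
  by rewrite integral0.
have QE : Q x = \int[leb]_s G s.
  apply: ae_eq_integral_raw => //.
    by move=> s; apply: mule_ge0; [rewrite lee_fin derive1_ge0|exact: pm0].
  apply: (@filterS _ _ (ae_filter_ringOfSetsType leb) _ _ _ dae) => s ds; rewrite /G.
  have [s0|s0] := leP s 0%R; first by rewrite pm_neg// !mule0.
  by rewrite slE//; exact: ds.
have slb n s : (0 < s)%R -> derivable f s 1 ->
    (backward_slope f (vanishing e n) s <= c * derive1 f s)%R.
  by move=> s0 ds; apply: sb => //; [exact: vanishing_gt0|exact: vanishing_le].
have slG n : {ae leb, forall s, sl n s * measure_density mu p s x <= c%:E * G s}.
  apply: (@filterS _ _ (ae_filter_ringOfSetsType leb) _ _ _ dae) => s ds; rewrite /G.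
  have [s0|s0] := leP s 0%R; first by rewrite pm_neg// !mule0.
  rewrite slE; last exact: ds.
  by rewrite muleA -EFinM; apply: lee_wpmul2r => //; rewrite lee_fin slb//; exact: ds.
split.
  rewrite QE; apply: (@cvg_integral_le_lim _ _ _ leb _ G c) => //.
  - by move=> n; exact: nslope.
  - apply: (@filterS _ _ (ae_filter_ringOfSetsType leb) _ _ _ dae) => s ds; rewrite /G.
    have [s0|s0] := leP s 0%R.
      rewrite pm_neg// mule0 (_ : (fun n => _) = cst 0); first exact: cvg_cst.
      by apply/funext => n; rewrite mule0.
    rewrite slE; last exact: ds.
    apply: (@cvg_scale_dominated _ _ _ c) => //.
    + by move=> n; rewrite backward_slope_ge0// vanishing_gt0.
    + by move=> n; apply: slb => //; exact: ds.
    + by apply: cvg_backward_slope => //; exact: ds.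
  - by apply: ae_foralln.
move=> n; rewrite QE -nn_integralZl//.
have [mF F0] := nslope n x e0; have [mG G0] := nnmeasZ (a := G) (c := c%:E) c0 nG.
apply: ae_ge0_le_integral => //.
by apply: (@filterS _ _ (ae_filter_ringOfSetsType leb) _ _ _ (slG n)) => s sG _.
Qed.

Local Notation h := (profile_integral mu p f).
Variable u : X -> R.
Hypothesis uL2 : u \in Lfun m 2%:E.

Local Notation pot g := (potential_part m mu p f u g).

Let nr := nnmeas_weight mu pd f_ge0 f_nd uL2.

Let nH e n : (0 < e)%R -> nnmeas (H e n).
Proof.
move=> e0; apply: (nnmeas_profile_integral mu pd).
by apply: nnmeas_backward_slope => //; exact: vanishing_gt0.
Qed.

(** Fatou's lemma in x, on top of its use in s for the inner integral. *)
Lemma potential_le_limn_einf e : (0 < e)%R ->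
  pot (derive1 f) <= limn_einf (fun n => pot (backward_slope f (vanishing e n))).
Proof.
move=> e0; have nF n := nnmeasM nr (nH n e0); have [_ r0] := nr.
have mF n := proj1 (nF n); have F0 n := proj2 (nF n).
apply: le_trans (fatou m measurableT mF (fun n x _ => F0 n x)).
apply: ge0_le_integral_raw => x.
  apply: mule_ge0; first exact: r0.
  by apply: integral_ge0 => s _; apply: mule_ge0; [rewrite lee_fin derive1_ge0|exact: pm0].
apply: limn_einf_scale; [exact: r0| |exact: derive_integral_le_limn_einf].
by move=> n; case: (nH n e0).
Qed.

Lemma cvg_potential : regular_profile f -> exists2 e : R, (0 < e)%R &
  pot (backward_slope f (vanishing e n)) @[n --> \oo] --> pot (derive1 f).
Proof.
move=> rf; have [e [c [e0 c0 sb]]] := slope_boundP f_nd (proj2 rf).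
exists e => //; have HQ x := cvg_derive_integral x rf e0 sb c0.
have [_ r0] := nr.
(* Measurability is inherited from the [H e n], whose pointwise limit is [Q]. *)
have nQ : nnmeas Q.
  split=> [|x].
    apply: (emeasurable_fun_cvg (fun n => H e n)).
      by move=> n; case: (nH n e0).
    by move=> x _; exact: (HQ x).1.
  by apply: integral_ge0 => s _; apply: mule_ge0; [rewrite lee_fin derive1_ge0|exact: pm0].
apply: (@cvg_integral_le_lim _ _ _ m _ _ c).
- by move=> n; apply: nnmeasM => //; exact: nH.
- exact: nnmeasM.
- by apply: aeW => x; apply: cvgeZl => //; exact: (HQ x).1.
- apply: aeW => x n; rewrite muleCA; apply: lee_wpmul2l; first exact: r0.
  exact: (HQ x).2.
Qed.

End potential_limit.

(** * Existence of the limits and the two conclusions *)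

Section limits.
Context (R : realType) d (X : measurableType d).
Variables (m mu : {sigma_finite_measure set X -> \bar R}).
Variable p : R -> X -> X -> \bar R.
Hypothesis pd : transition_density m p.
Variable f : R -> R.
Hypothesis f_ge0 : forall s : R, (0 <= f s)%R.
Hypothesis f_nd : {homo f : s t / (s <= t)%R}.
Hypothesis f_eq0 : forall s : R, (s <= 0)%R -> f s = 0%R.
Local Notation h := (profile_integral mu p f).
Variable u : X -> R.
Hypothesis uL2 : u \in Lfun m 2%:E.
Hypothesis u_eq0 : forall x, h x = 0 \/ h x = +oo -> u x = 0%R.

Local Notation N := (sqr_norm m mu p f u).
Local Notation phi := (form_part m p u).
Local Notation beta := (mass_part m mu p f u).
Local Notation J := (remainder_form m p h u).
Local Notation pot g := (potential_part m mu p f u g).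

Let le_subD (c c' x y e : R) : (c <= c')%R -> (y <= x + e)%R ->
  (c - x <= c' - y + e)%R.
Proof. lra. Qed.

Let phi_usc (T e : R) : (0 < T)%R -> (0 < e)%R -> exists2 del : R, (0 < del)%R &
  forall s, (T - del < s)%R -> (s <= T)%R -> (0 < s)%R /\ (phi s <= phi T + e)%R.
Proof.
move=> T0 e0.
have [del del0 le] := midpoint_convex_left_usc
  (form_part_convex pd f_ge0 f_nd f_eq0 uL2 u_eq0)
  (form_part_bound pd f_ge0 f_nd f_eq0 uL2 u_eq0) T0 e0.
(* The cut at T keeps s positive, as the monotonicity of beta requires. *)
exists (Num.min del T); first by rewrite lt_min del0 T0.
move=> s sd sT; split.
  apply: le_lt_trans sd; rewrite subr_ge0 ge_min lexx orbT//.
by apply: le => //; apply: le_lt_trans sd; rewrite lerB// ge_min lexx.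
Qed.

Let cvg_right (F : R -> \bar R) (D : R -> R) (L : \bar R) :
  (forall t, (0 < t)%R -> F t = (D t / t)%:E) ->
  (D t / t)%:E @[t --> 0%R^'+] --> L -> F t @[t --> 0%R^'+] --> L.
Proof.
move=> FD; apply: cvg_trans; apply: near_eq_cvg; near=> t.
by rewrite FD//; near: t; exact: nbhs_right_gt.
Unshelve. all: by end_near. Qed.

Lemma is_cvg_approx_form : cvg (approx_form m p u t @[t --> 0%R^'+]).
Proof.
apply/cvg_ex; eexists.
apply: (cvg_right (approx_formE pd f_ge0 f_nd f_eq0 uL2 u_eq0)).
apply: (@cvg_rate_at0 R (fun t => N - phi t)%R) => [t t0|n t n0 t0|T e T0 e0].
- have := form_part_bound pd f_ge0 f_nd f_eq0 uL2 u_eq0 t0.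
  by rewrite subr_ge0 => /ler_normlW.
- exact: (form_part_rate pd f_ge0 f_nd f_eq0 uL2 u_eq0).
- have [del del0 le] := phi_usc T0 e0; exists del => // s sd sT.
  by have [_] := le s sd sT; exact: le_subD.
Qed.

Lemma is_cvg_remainder_form : cvg (J t @[t --> 0%R^'+]).
Proof.
apply/cvg_ex; eexists.
apply: (cvg_right (remainder_formE pd f_ge0 f_nd f_eq0 uL2 u_eq0)).
apply: (@cvg_rate_at0 R (fun t => beta t - phi t)%R) => [t t0|n t n0 t0|T e T0 e0].
- exact: (square_part_ge0 pd f_ge0 f_nd f_eq0 uL2 u_eq0).
- exact: (square_part_rate pd f_ge0 f_nd f_eq0 uL2 u_eq0).
- have [del del0 le] := phi_usc T0 e0; exists del => // s sd sT.
  have [s0 le_phi] := le s sd sT.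
  apply: le_subD le_phi.
  exact: (mass_part_nonincreasing pd f_ge0 f_nd f_eq0 uL2 u_eq0 s0 sT).
Qed.

Let splitE e n : (0 < e)%R -> approx_form m p u (vanishing e n) =
  pot (backward_slope f (vanishing e n)) + J (vanishing e n).
Proof.
move=> e0; have t0 := vanishing_gt0 n e0.
rewrite (approx_formE pd f_ge0 f_nd f_eq0 uL2 u_eq0 t0).
rewrite (remainder_formE pd f_ge0 f_nd f_eq0 uL2 u_eq0 t0).
rewrite (potential_partE pd f_ge0 f_nd f_eq0 uL2 u_eq0 t0) -EFinD; congr EFin.
by rewrite -mulrDl; congr (_ / _)%R; ring.
Qed.

Let along (F : R -> \bar R) e : (0 < e)%R -> cvg (F t @[t --> 0%R^'+]) ->
  F (vanishing e n) @[n --> \oo] --> lim (F t @[t --> 0%R^'+]).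
Proof. by move=> e0 cF; apply: cvg_comp (cvg_vanishing_right e0) cF. Qed.

Let pot_fin e n : (0 < e)%R ->
  pot (backward_slope f (vanishing e n)) \is a fin_num /\
  J (vanishing e n) \is a fin_num.
Proof.
move=> e0; have t0 := vanishing_gt0 n e0.
by rewrite (potential_partE pd f_ge0 f_nd f_eq0 uL2 u_eq0 t0)
  (remainder_formE pd f_ge0 f_nd f_eq0 uL2 u_eq0 t0).
Qed.

Let J_ge0 e n : (0 < e)%R -> 0 <= J (vanishing e n).
Proof.
move=> e0; have t0 := vanishing_gt0 n e0.
rewrite (remainder_formE pd f_ge0 f_nd f_eq0 uL2 u_eq0 t0) lee_fin.
apply: divr_ge0; last exact: ltW.
exact: (square_part_ge0 pd f_ge0 f_nd f_eq0 uL2 u_eq0).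
Qed.

Let pot_ge0 e n : (0 < e)%R -> 0 <= pot (backward_slope f (vanishing e n)).
Proof.
move=> e0; have t0 := vanishing_gt0 n e0.
rewrite (potential_partE pd f_ge0 f_nd f_eq0 uL2 u_eq0 t0) lee_fin.
apply: divr_ge0; last exact: ltW.
by rewrite subr_ge0; exact: (mass_part_le pd f_ge0 f_nd f_eq0 uL2 u_eq0).
Qed.

Lemma lim_remainder_form_ge0 : 0 <= lim (J t @[t --> 0%R^'+]).
Proof.
have cJ := along ltr01 is_cvg_remainder_form.
rewrite -(cvg_lim _ cJ)//; apply: lime_ge; first by apply/cvg_ex; eexists; exact: cJ.
by apply: nearW => n; exact: J_ge0.
Qed.

Lemma potential_remainder_le :
  pot (derive1 f) + lim (J t @[t --> 0%R^'+]) <= quad_form m p u.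
Proof.
have cE := along ltr01 is_cvg_approx_form.
have cJ := along ltr01 is_cvg_remainder_form.
have potle := potential_le_limn_einf mu pd f_ge0 f_nd uL2 ltr01.
rewrite /quad_form; set E := lim (approx_form m p u t @[t --> 0%R^'+]) in cE *.
set L := lim (J t @[t --> 0%R^'+]) in cJ *.
(* For finite E the remainder has a finite limit L, so the potential part converges to E - L and
   Fatou's bound can be compared with this limit. *)
have [->|Eoo] := eqVneq E +oo; first exact: leey.
have L0 : 0 <= L by exact: lim_remainder_form_ge0.
have LE : L <= E.
  rewrite -(cvg_lim _ cJ)// -(cvg_lim _ cE)//.
  apply: lee_lim; [by apply/cvg_ex; eexists; exact: cJ|by apply/cvg_ex; eexists; exact: cE|].
  apply: nearW => n.
  by rewrite splitE// leeDr// pot_ge0.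
have Lf : L \is a fin_num by rewrite ge0_fin_numE// (le_lt_trans LE)// ltey.
have cA : pot (backward_slope f (vanishing 1%R n)) @[n --> \oo] --> E - L.
  have -> : (fun n => pot (backward_slope f (vanishing 1%R n))) =
      (fun n => approx_form m p u (vanishing 1%R n) - J (vanishing 1%R n)).
    apply/funext => n; rewrite splitE// addeK//.
    by have [] := pot_fin n ltr01.
  apply: cvgeB => //; apply: fin_num_adde_defl.
  by rewrite fin_numN.
have [Ae _] := cvg_limn_einf_sup cA.
by rewrite -leeBrDr// -Ae.
Qed.

(** Both full limits exist, so they may be computed along the one sequence on which the potential
    part is known to converge, possibly to [+oo]. *)
Lemma potential_remainder_eq : regular_profile f ->
  quad_form m p u = pot (derive1 f) + lim (J t @[t --> 0%R^'+]).
Proof.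
move=> rf; have [e e0 cA] := cvg_potential mu pd f_ge0 f_nd uL2 rf.
have cE := along e0 is_cvg_approx_form.
have cJ := along e0 is_cvg_remainder_form.
have A0 : 0 <= pot (derive1 f).
  rewrite -(cvg_lim _ cA)//; apply: lime_ge; first by apply/cvg_ex; eexists; exact: cA.
  by apply: nearW => n; exact: pot_ge0.
have cAJ := cvgeD (ge0_adde_def A0 lim_remainder_form_ge0) cA cJ.
have splitE' : (fun n => approx_form m p u (vanishing e n)) =
    (fun n => pot (backward_slope f (vanishing e n))) \+ (fun n => J (vanishing e n)).
  by apply/funext => n; exact: splitE.
rewrite -splitE' in cAJ.
exact: (cvg_unique (@ereal_hausdorff R) cE (cAJ _)).
Qed.

Lemma limf_einf_le_lim (F : R -> \bar R) : cvg (F t @[t --> 0%R^'+]) ->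
  limf_einf F 0%R^'+ <= lim (F t @[t --> 0%R^'+]).
Proof.
move=> cF; rewrite limf_einfE; apply: ge_ereal_sup => _ [V /= FV <-].
apply: lime_ge => //; apply: filterS FV => t Vt.
by apply: ereal_inf_lbound; exists t.
Qed.

End limits.

Unset Implicit Arguments.
Set Strict Implicit.

Theorem theorem2 (R : realType) (d : measure_display) (X : measurableType d)
    (m : {sigma_finite_measure set X -> \bar R})
    (p : R -> X -> X -> \bar R)
    (p_density : transition_density m p)
    (f : R -> R)
    (f_ge0 : forall s : R, (0 <= f s)%R)
    (f_nondecreasing : {homo f : s t / (s <= t)%R})
    (f_eq0 : forall s : R, (s <= 0)%R -> f s = 0%R)
    (mu : {sigma_finite_measure set X -> \bar R}) :
  let h := hardy_h p f mu in
  let q := hardy_q p f mu in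
  let E := quad_form m p in
  let J := remainder_form m p h in
  (forall u : X -> R, u \in Lfun m 2%:E ->
     (forall x : X, h x = 0 \/ h x = +oo -> u x = 0%R) ->
     \int[m]_x (((u x) ^+ 2)%:E * q x) + limf_einf (J u) 0%R^'+ <= E u)
  /\
  (power_profile f \/ (absolutely_continuous_fun f /\ slope_bound f) ->
   forall u : X -> R, u \in Lfun m 2%:E ->
     (forall x : X, h x = 0 \/ h x = +oo -> u x = 0%R) ->
     cvg (J u t @[t --> 0%R^'+]) /\
     E u = \int[m]_x (((u x) ^+ 2)%:E * q x) + lim (J u t @[t --> 0%R^'+])).
Proof.
have hE : hardy_h p f mu = profile_integral mu p f.
  by apply/funext => x; exact: profile_integralE.
move=> h q E J; rewrite {}/J {}/E {}/h hE.
have potE (u : X -> R) :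
    \int[m]_x ((u x ^+ 2)%:E * q x) = potential_part m mu p f u (derive1 f).
  apply: eq_integral => x _; rewrite /q /hardy_q hE profile_integralE /=.
  (* Where h is 0 or [+oo], q is 0 by definition and the weight u^2 / fine(h) is 0 by the convention
     on division. *)
  case: ifPn => [/orP[] /eqP ->|_]; last by rewrite muleA -EFinM.
    by rewrite mule0 /= invr0 mulr0 mul0e.
  by rewrite mule0 /= invr0 mulr0 mul0e.
split=> [u uL2 u0|profile u uL2 u0]; rewrite potE.
  apply: (le_trans _
    (potential_remainder_le p_density f_ge0 f_nondecreasing f_eq0 uL2 u0)).
  apply: leeD => //; apply: limf_einf_le_lim.
  exact: (is_cvg_remainder_form p_density f_ge0 f_nondecreasing f_eq0 uL2 u0).
split; first exact: (is_cvg_remainder_form p_density f_ge0 f_nondecreasing f_eq0 uL2 u0).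
apply: (potential_remainder_eq p_density f_ge0 f_nondecreasing f_eq0 uL2 u0).
exact: regular_profileP f_nondecreasing (f_eq0 _ (lexx _)) profile.
Qed.
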